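(* Let $p\ge1$ and assume that $\mathbb E\big[(G_{X_1}(X_1))^p\big]\le A_1(p)$ and $\mathbb E\big[(G_\varepsilon(\varepsilon))^p\big]\le A_2(p)$ for some finite constants $A_1(p)$ and $A_2(p)$. Then there exists a constant $C_0$, not depending on $n$, such that for all $n\ge1$: (i) if $p\in[1,2]$, $\ \big\|W_1(\mu_n,\mu)-\mathbb E[W_1(\mu_n,\mu)]\big\|_p^p\le\dfrac{C_0}{n^{p-1}}$; (ii) if $p\ge2$, $\ \big\|W_1(\mu_n,\mu)-\mathbb E[W_1(\mu_n,\mu)]\big\|_p^p\le\dfrac{C_0}{n^{p/2}}$.
   Context: $(\mathcal X,d)$ and $(\mathcal Y,\delta)$ are complete separable metric spaces; $(\varepsilon_i)_{i\ge1}$ is a sequence of iid $\mathcal Y$-valued random variables; $X_1$ is an $\mathcal X$-valued random variable independent of $(\varepsilon_i)_{i\ge2}$. The Markov chain is $X_n=F(X_{n-1},\varepsilon_n)$ for $n\ge2$, where $F:\mathcal X\times\mathcal Y\to\mathcal X$ is measurable and satisfies, for some $\rho\in[0,1)$ and $C>0$, $\mathbb E[d(F(x,\varepsilon_1),F(x',\varepsilon_1))]\le\rho\,d(x,x')$ for all $x,x'\in\mathcal X$, and $d(F(x,y),F(x,y'))\le C\,\delta(y,y')$ for all $x\in\mathcal X$, $y,y'\in\mathcal Y$. $\mu$ denotes the unique invariant distribution of the chain and $\mu_n=\frac1n\sum_{k=1}^n\delta_{X_k}$ the empirical distribution (here $\delta_{X_k}$ is a Dirac mass). $G_{X_1}(x)=\int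 d(x,x')P_{X_1}(dx')$ and $G_\varepsilon(y)=\int C\,\delta(y,y')P_\varepsilon(dy')$, where $P_{X_1}$ is the law of $X_1$ and $P_\varepsilon$ the common law of the $\varepsilon_k$'s; $G_\varepsilon(\varepsilon)$ denotes a random variable distributed as $G_\varepsilon(\varepsilon_k)$. For probability measures $\nu_1,\nu_2$ on $(\mathcal X,d)$, $W_1(\nu_1,\nu_2)=\inf_{\lambda\in M(\nu_1,\nu_2)}\int d(x,y)\,\lambda(dx,dy)$, where $M(\nu_1,\nu_2)$ is the set of probability measures on $\mathcal X\times\mathcal X$ with margins $\nu_1$ and $\nu_2$. $\|Z\|_p=(\mathbb E|Z|^p)^{1/p}$. *)

(* Defs.v *)
From HB Require Import structures.
From mathcomp Require Import all_boot all_order all_algebra finmap.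
From mathcomp Require Import all_classical all_reals all_analysis.

Set Implicit Arguments.
Unset Strict Implicit.
Unset Printing Implicit Defensive.

Import Order.TTheory GRing.Theory Num.Theory.

Local Open Scope classical_set_scope.
Local Open Scope ring_scope.
Local Open Scope ereal_scope.

(* The base point carried by this structure is no restriction: all the spaces
   considered are nonempty, since they are targets of random variables. *)
#[short(type="completeMetricType")]
HB.structure Definition CompleteMetric (R : numDomainType) :=
  {T of CompletePseudoMetric R T & Metric R T}.

Definition separable_space (T : topologicalType) : Prop :=
  exists2 D : set T, countable D & dense D.

Notation borel T := (g_sigma_algebraType (@open T)).

Section independence.
Context {d d' d1 : measure_display} {T : measurableType d}
  {T' : measurableType d'} {T1 : measurableType d1} {R : realType}.
Variable P : probability T R.

Definition mutually_independent (I : set nat) (X : nat -> T -> T') : Prop :=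
  forall (J : {fset nat}) (A : nat -> set T'),
    (forall i, i \in J -> I i) -> (forall i, measurable (A i)) ->
    P (\bigcap_(i in [set` J]) (X i @^-1` A i)) =
    \prod_(i <- J) P (X i @^-1` A i).

Definition sigma_family (I : set nat) (X : nat -> T -> T') : set (set T) :=
  <<s \bigcup_(i in I) preimage_set_system [set: T] (X i) measurable >>.

Definition independent_of_family (Y : T -> T1) (I : set nat)
    (X : nat -> T -> T') : Prop :=
  forall (A : set T1) (B : set T), measurable A -> sigma_family I X B ->
    P (Y @^-1` A `&` B) = P (Y @^-1` A) * P B.

Definition identically_distributed (I : set nat)
    (X : nat -> {RV P >-> T'}) : Prop :=
  forall i j, I i -> I j -> forall A, measurable A ->
    distribution P (X i) A = distribution P (X j) A.

End independence.

Section wasserstein.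
Context {R : realType} {X : completeMetricType R}.

(* W1 takes values in \bar R: it may be +oo when a first moment is infinite.
   The product sigma-algebra on X * X is its Borel sigma-algebra as soon as
   X is separable. *)
Definition couplings (nu1 nu2 : set (borel X) -> \bar R) :
    set (probability (borel X * borel X)%type R) :=
  [set lambda | forall A : set (borel X), measurable A ->
     lambda (A `*` [set: borel X]) = nu1 A /\
     lambda ([set: borel X] `*` A) = nu2 A].

Definition W1 (nu1 nu2 : set (borel X) -> \bar R) : \bar R :=
  ereal_inf [set \int[lambda]_z (mdist (z.1 : X) (z.2 : X))%:E
            | lambda in couplings nu1 nu2].

End wasserstein.

Section chain.
Context {R : realType} {X : completeMetricType R}.

(* msum sums over k = 0, ..., n - 1; the shift selects x 1, ..., x n, x 0 being
   unused. *)
Definition empirical (x : nat -> borel X) (n : nat) :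
    {measure set (borel X) -> \bar R} :=
  mscale ((n%:R^-1)%:nng)%R (msum (fun k => \d_(x k.+1)) n).

Context {Y : completeMetricType R} {d : measure_display}
  {Omega : measurableType d} {P : probability Omega R}.

(* mu K = mu, where K x is the law of F (x, e). *)
Definition invariant_distribution (F : borel X * borel Y -> borel X)
    (e : {RV P >-> borel Y}) (mu : probability (borel X) R) : Prop :=
  forall A : set (borel X), measurable A ->
    \int[mu]_x P ((fun w => F (x, e w)) @^-1` A) = mu A.

(* G_{X_1} is Gdist 1 X_1 and G_eps is Gdist C (eps 1). *)
Definition Gdist {Z : completeMetricType R} (c : R)
    (xi : {RV P >-> borel Z}) (x : Z) : \bar R :=
  \int[distribution P xi]_x' (c * mdist x (x' : Z))%R%:E.

End chain.

(* Main.v *)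
Require Import Defs.
From HB Require Import structures.
From mathcomp Require Import all_boot all_order all_algebra finmap.
From mathcomp Require Import all_classical all_reals all_analysis.
From mathcomp Require Import measurable_realfun.
From mathcomp Require Import ring lra.

Set Implicit Arguments.
Unset Strict Implicit.
Unset Printing Implicit Defensive.

Import Order.TTheory GRing.Theory Num.Theory.

Local Open Scope classical_set_scope.
Local Open Scope ring_scope.
Local Open Scope ereal_scope.

(** The distance W_1(mu_n, mu) is a function f of the path (X_1, ..., X_n) which
    is Lipschitz in each coordinate with constant 1/n ([W1_lipschitz]): a
    coupling of the empirical distribution with mu is a way to send the mass 1/n
    of each point somewhere, and the same way can be used after the points have
    moved.

    The conditional expectation of such a function given the path up to an
    earlier time is again a Lipschitz function of that path, and thanks to the
    contraction the constant in the last coordinate never exceeds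
    B = 1/(n (1 - rho)), the sum of the geometric series of the effects of one
    position on the later ones ([next_mean_lipschitz]).  So the martingale
    increments of f are bounded by B G_eps(eps_k), or B G_{X_1}(X_1) for the
    first one, and their p-th moments are of order n^(-p).

    It remains to bound the p-th moment of a sum of n martingale increments.  For
    p in [1, 2] this is the von Bahr-Esseen inequality, of order n * n^(-p), and
    for p >= 2 a Burkholder type inequality, of order n^(p/2) * n^(-p).  Both
    follow from a pointwise inequality
      |a + b|^p <= (1 + kap) |a|^p + (slope of |.|^p at a) b + L |b|^p
    ([powR_smooth_le2], [powR_smooth_ge2]), where the linear term has mean zero
    when b is the increment given the past.  Conditioning is expressed by
    Fubini's theorem on the product of the sample space, carrying the
    sigma-algebra of the past, with the space of the noise
    ([ge0_integral_indep], [past_indep], [chain_moment]).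

    The distance is finite only if mu has a first moment, which follows from
    invariance and the contraction ([invariant_moment]). *)

(** * Smoothness of the p-th power *)

Section real_inequalities.
Local Open Scope ring_scope.
Context {R : realType}.
Implicit Types a b c p u k : R.

(** exp u = 1 / exp (- u) <= 1 / (1 - u), and 1 / (1 - u) is compared with its
    second order expansion. *)
Lemma expR_le_quadratic u : `|u| <= 1/2 -> expR u <= 1 + u + 2 * u ^+ 2.
Proof.
rewrite ler_norml => /andP[u1 u2].
have e1 : 1 - u <= expR (- u) by exact: expR_ge1Dx.
have u0 : 0 < 1 - u by lra.
have -> : expR u = (expR (- u))^-1 by rewrite expRN invrK.
apply: (@le_trans _ _ ((1 - u)^-1)).
  by rewrite lef_pV2// posrE ?expR_gt0.
rewrite -[leLHS]mul1r ler_pdivrMr//; nra.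
Qed.

(** The derivative of t |-> |t|^p at a, in a form that vanishes at a = 0. *)
Definition powR_slope p a : R := p * `|a| `^ p / a.

(** The first summand serves the case |a| <= 2 p |b|, where a + b and a are at
    most of the order of b; the second one is the constant of the second order
    remainder in the opposite case. *)
Definition smooth_const p : R := 2 * (1 + 2 * p) `^ p + 2 * p ^+ 2.

Lemma smooth_const_ge0 p : 0 <= smooth_const p.
Proof. by rewrite addr_ge0// mulr_ge0// ?powR_ge0 ?sqr_ge0. Qed.

(** When |a| dominates |b|, put u = b / a: then |1 + u|^p <= exp (p u) because
    1 + u <= exp u, and exp (p u) is at most quadratic in u since |p u| <= 1/2.
    This replaces a Taylor expansion of the power. *)
Lemma powR_smooth p a b : 1 <= p ->
  `|a + b| `^ p <= `|a| `^ p + powR_slope p a * b + smooth_const p * `|b| `^ p \/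
  [/\ a != 0, 2 * p * `|b| < `|a| & `|a + b| `^ p <=
    `|a| `^ p + powR_slope p a * b + 2 * p ^+ 2 * (`|a| `^ p * (b / a) ^+ 2)].
Proof.
move=> p1; have p0 : 0 < p by lra.
have [ab|ab] := lerP `|a| (2 * p * `|b|); [left|right].
- have h1 : `|a + b| `^ p <= (1 + 2 * p) `^ p * `|b| `^ p.
    rewrite -powRM//; last lra.
    apply: ge0_ler_powR; rewrite ?nnegrE//; first lra.
      by rewrite mulr_ge0//; lra.
    by apply: (le_trans (ler_normD _ _)); lra.
  have h2 : - (powR_slope p a * b) <= (1 + 2 * p) `^ p * `|b| `^ p.
    apply: (le_trans (ler_norm _)); rewrite normrN /powR_slope !normrM normfV.
    have [->|a0] := eqVneq a 0.
      by rewrite normr0 invr0 mulr0 mul0r mulr_ge0// powR_ge0.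
    rewrite (ger0_norm (powR_ge0 _ _)) (gtr0_norm p0).
    have a0' : 0 < `|a| by rewrite normr_gt0.
    have -> : p * `|a| `^ p * `|a|^-1 * `|b| = p * (`|b| * `|a| `^ (p - 1)).
      by rewrite -(@mulr_powRB1 _ `|a| p)//; field; rewrite gt_eqF.
    apply: (@le_trans _ _ (p * (`|b| * (2 * p * `|b|) `^ (p - 1)))).
      rewrite ler_wpM2l ?(ltW p0)// ler_wpM2l//.
      by apply: ge0_ler_powR; rewrite ?nnegrE//; [lra|rewrite mulr_ge0//; lra].
    apply: (@le_trans _ _ ((2 * p * `|b|) `^ p)).
      rewrite -(@mulr_powRB1 _ (2 * p * `|b|) p)//; last by rewrite mulr_ge0//; lra.
      rewrite !mulrA ler_wpM2r ?powR_ge0//.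
      rewrite ler_wpM2r//; lra.
    rewrite -powRM//; last lra.
    by apply: ge0_ler_powR; rewrite ?nnegrE//; rewrite ?mulr_ge0 ?ler_wpM2r//; lra.
  have h3 : 0 <= `|a| `^ p by exact: powR_ge0.
  have h4 : 0 <= 2 * p ^+ 2 * `|b| `^ p by rewrite mulr_ge0 ?powR_ge0// mulr_ge0 ?sqr_ge0.
  rewrite /smooth_const; lra.
- have a0 : a != 0.
    by apply/eqP => a0; move: ab; rewrite a0 normr0 ltNge mulr_ge0//; lra.
  split => //.
  have a0' : 0 < `|a| by rewrite normr_gt0.
  set u := b / a.
  have -> : b = a * u by rewrite /u mulrCA mulfV ?mulr1.
  have u1 : p * `|u| < 1 / 2.
    rewrite /u normrM normfV mulrA ltr_pdivrMr//; lra.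
  have u2 : `|u| < 1 / 2.
    by have := normr_ge0 u; nra.
  have u3 := u2; move: u3; rewrite ltr_norml => /andP[u3 u4].
  have -> : a + a * u = a * (1 + u) by rewrite mulrDr mulr1.
  have -> : powR_slope p a * (a * u) = `|a| `^ p * (p * u).
    by rewrite /powR_slope mulrA divfK// (mulrC p) mulrA.
  have h : (1 + u) `^ p <= 1 + p * u + 2 * (p * u) ^+ 2.
    apply: (@le_trans _ _ (expR (u * p))).
      rewrite expRM; apply: ge0_ler_powR; rewrite ?nnegrE ?expR_ge0//; [lra|lra|].
      exact: expR_ge1Dx.
    rewrite mulrC; apply: expR_le_quadratic.
    by rewrite normrM (gtr0_norm p0) ltW.
  rewrite normrM powRM// (gtr0_norm (_ : 0 < 1 + u)); last lra.
  have -> : `|a| `^ p + `|a| `^ p * (p * u) + 2 * p ^+ 2 * (`|a| `^ p * u ^+ 2)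
    = `|a| `^ p * (1 + p * u + 2 * (p * u) ^+ 2) by ring.
  by rewrite ler_wpM2l// powR_ge0.
Qed.

(** The von Bahr-Esseen form: for p <= 2 and |b| <= |a| the second order term
    |a|^p (b / a)^2 is below |a|^p |b / a|^p = |b|^p. *)
Lemma powR_smooth_le2 p a b : 1 <= p -> p <= 2 ->
  `|a + b| `^ p <= `|a| `^ p + powR_slope p a * b + smooth_const p * `|b| `^ p.
Proof.
move=> p1 p2; have [//|[a0 ab /le_trans]] := powR_smooth a b p1; apply.
rewrite lerD2l.
apply: (@le_trans _ _ (2 * p ^+ 2 * `|b| `^ p)); last first.
  by rewrite ler_wpM2r ?powR_ge0// lerDr mulr_ge0// powR_ge0.
rewrite ler_wpM2l//; first by rewrite mulr_ge0// sqr_ge0.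
have a0' : 0 < `|a| by rewrite normr_gt0.
have -> : `|b| `^ p = `|a| `^ p * (`|b / a|) `^ p.
  by rewrite -powRM// normrM normfV mulrCA mulfV ?mulr1// gt_eqF.
rewrite ler_wpM2l ?powR_ge0//.
have [->|b0] := eqVneq b 0; first by rewrite mul0r expr0n powR_ge0.
have u0 : 0 < `|b / a| by rewrite normr_gt0 mulf_neq0 ?invr_eq0.
have u1 : `|b / a| <= 1.
  by rewrite normrM normfV ler_pdivrMr// mul1r; have := normr_ge0 b; nra.
have -> : (b / a) ^+ 2 = `|b / a| `^ 2 by rewrite powR_mulrn// -normrX ger0_norm ?sqr_ge0.
by rewrite ger_powR// u0 u1.
Qed.

(** The form used for p >= 2.  The second order term |a|^p (b / a)^2 is either
    at most |a|^p / N, or else (b / a)^2 > 1 / N and it is absorbed by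
    N^(p/2 - 1) |b|^p.  With N the number of steps, the factor (1 + O(1/N))
    stays bounded over N steps, and the N remainders add up to the order
    N^(p/2). *)
Lemma powR_smooth_ge2 p a b N : 2 <= p -> 1 <= N ->
  `|a + b| `^ p <= (1 + 2 * p ^+ 2 / N) * `|a| `^ p + powR_slope p a * b +
    smooth_const p * N `^ (p / 2 - 1) * `|b| `^ p.
Proof.
move=> p2 N1; have p1 : 1 <= p by lra.
have N0 : 0 < N by lra.
have c1 : 1 <= N `^ (p / 2 - 1) by rewrite -[leLHS](powRr0 N) ler_powR//; lra.
have p20 : 0 <= 2 * p ^+ 2 by rewrite mulr_ge0// sqr_ge0.
have b0 : 0 <= `|b| `^ p by exact: powR_ge0.
have a0 : 0 <= `|a| `^ p by exact: powR_ge0.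
have [/le_trans|[aN0 ab /le_trans]] := powR_smooth a b p1; apply.
  apply: lerD; first by rewrite lerD2r ler_peMl// lerDl divr_ge0// ltW.
  by rewrite ler_wpM2r// ler_peMr// smooth_const_ge0.
set u := b / a.
suff : 2 * p ^+ 2 * (`|a| `^ p * u ^+ 2) <= 2 * p ^+ 2 / N * `|a| `^ p +
    smooth_const p * N `^ (p / 2 - 1) * `|b| `^ p.
  by rewrite mulrDl mul1r; lra.
suff h : `|a| `^ p * u ^+ 2 <= N^-1 * `|a| `^ p + N `^ (p / 2 - 1) * `|b| `^ p.
  apply: (@le_trans _ _ (2 * p ^+ 2 * (N^-1 * `|a| `^ p + N `^ (p / 2 - 1) * `|b| `^ p))).
    by rewrite ler_wpM2l.
  rewrite [leLHS]mulrDr; apply: lerD; first by rewrite mulrA.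
  rewrite mulrA ler_wpM2r// ler_wpM2r ?powR_ge0//.
  by rewrite /smooth_const lerDr mulr_ge0// powR_ge0.
have a0' : 0 < `|a| by rewrite normr_gt0.
have -> : `|b| `^ p = `|a| `^ p * `|u| `^ p.
  by rewrite -powRM// normrM normfV mulrCA mulfV ?mulr1// gt_eqF.
have -> : N^-1 * `|a| `^ p + N `^ (p / 2 - 1) * (`|a| `^ p * `|u| `^ p)
  = `|a| `^ p * (N^-1 + N `^ (p / 2 - 1) * `|u| `^ p) by ring.
rewrite ler_wpM2l//.
have v0 : 0 <= N `^ (p / 2 - 1) * `|u| `^ p by rewrite mulr_ge0 ?powR_ge0.
have [uN|uN] := lerP (u ^+ 2) N^-1; first lra.
have u20 : 0 < u ^+ 2 by rewrite (lt_trans _ uN)// invr_gt0.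
have u0 : 0 < `|u| by rewrite normr_gt0 -sqrf_eq0 gt_eqF.
have u2E : u ^+ 2 = `|u| `^ 2 by rewrite powR_mulrn// -normrX ger0_norm ?ltW.
have w1 : 1 <= N `^ (p / 2 - 1) * `|u| `^ (p - 2).
  have -> : p - 2 = 2 * (p / 2 - 1) by field.
  rewrite powRrM -u2E -powRM ?(ltW u20)// ?(ltW N0)//.
  apply: (@le_trans _ _ (1 `^ (p / 2 - 1))); first by rewrite powR1.
  apply: ge0_ler_powR; rewrite ?nnegrE//; first lra.
    by rewrite mulr_ge0// ltW.
  by rewrite -ler_pdivrMl// mulr1 ltW.
apply: (@le_trans _ _ (N `^ (p / 2 - 1) * `|u| `^ p)); last by rewrite lerDr invr_ge0 ltW.
have -> : `|u| `^ p = `|u| `^ (p - 2) * u ^+ 2.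
  rewrite u2E -powRD ?subrK//; apply/implyP => _; exact: lt0r_neq0.
by rewrite mulrA ler_peMl// ltW.
Qed.

End real_inequalities.

(** * Measurability of Lipschitz functions on separable metric spaces *)

Section lipschitz_measurability.
Local Open Scope ring_scope.
Context {R : realType}.

Lemma measurable_fun_sublevel d (S : measurableType d) (f : S -> R) :
  (forall t, measurable [set s | f s < t]) -> measurable_fun setT f.
Proof.
move=> mf _; apply: (measurability _ (RGenInftyO.measurableE R)) => //.
move=> _ [_ [t ->] <-]; rewrite setTI.
by rewrite (_ : _ @^-1` _ = [set s | f s < t])//; apply/seteqP; split => s;
  rewrite /= in_itv.
Qed.

Context {X : completeMetricType R}.

Lemma mdist_lipschitz (a b a' b' : X) :
  `|mdist a b - mdist a' b'| <= mdist a a' + mdist b b'.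
Proof.
have h1 := metric_triangle a a' b; have h2 := metric_triangle a' b' b.
have h3 := metric_triangle a' a b'; have h4 := metric_triangle a b b'.
have h5 := metric_sym a a'; have h6 := metric_sym b b'.
by rewrite ler_norml; lra.
Qed.

Lemma separable_seq : separable_space X ->
  exists q : nat -> X, forall (x : X) (e : R), 0 < e -> exists j, mdist x (q j) < e.
Proof.
move=> [D cD dD]; have /pcard_surjP[q qD] := cD.
exists q => x e e0.
have [z [zB Dz]] : ball x e `&` D !=set0.
  have [U [xU oU UB]] : exists U : set X, [/\ U x, open U & U `<=` ball x e].
    have /nbhs_interior/nbhs_singleton := nbhsx_ballx x e e0.
    by move=> xb; exists (interior (ball x e)); split => //;
      [exact: open_interior|exact: interior_subset].
  have [|z [Uz Dz]] := dD U _ oU; first by exists x.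
  by exists z; split => //; exact: UB.
have [j _ jz] := qD z Dz; exists j; rewrite jz.
by move: zB; rewrite ballEmdist.
Qed.

Lemma measurable_mdistl d (S : measurableType d) (f : S -> borel X) (z : X) :
  measurable_fun setT f -> measurable_fun setT (fun s => mdist z (f s : X)).
Proof.
move=> mf; apply: (@measurableT_comp _ _ _ _ _ _ (fun x : borel X => mdist z (x : X))) => //.
apply: measurable_fun_sublevel => t.
apply: sub_sigma_algebra => /=.
rewrite openE => x /= xt; rewrite /interior/=.
have e0 : 0 < t - mdist z x by rewrite subr_gt0.
apply: filterS (nbhsx_ballx x _ e0) => y; rewrite ballEmdist /= => xy.
by have := metric_triangle z x y; lra.
Qed.

(** A Lipschitz function is the infimum of the functions
    g(u) + B * distance to u, for u in a countable dense set of points.  So it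
    stays measurable after composition with measurable coordinates, without
    comparing the Borel sets of a product with the product of Borel sets. *)
Lemma measurable_lipschitz d (S : measurableType d) (sepX : separable_space X)
    (k : nat) (B : R) (g : (nat -> X) -> R) (Z : nat -> S -> borel X) :
  0 <= B ->
  (forall x x', `|g x - g x'| <= B * \sum_(i < k) mdist (x i) (x' i)) ->
  (forall i, (i < k)%N -> measurable_fun setT (Z i)) ->
  measurable_fun setT (fun s => g (fun i => Z i s : X)).
Proof.
move=> B0 gL mZ; have [q qdense] := separable_seq sepX.
pose u (j : seq nat) (i : nat) : X := q (nth 0%N j i).
pose M (j : seq nat) (s : S) := g (u j) + B * \sum_(i < k) mdist (u j i) (Z i s : X).
apply: measurable_fun_sublevel => t.
rewrite (_ : [set s | _] = \bigcup_j [set s | M j s < t]).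
  apply: countable_bigcupT_measurable => // j.
  have mM : measurable_fun setT (M j).
    apply: measurable_funD => //; apply: measurable_funM => //.
    by apply: measurable_sum => i; apply: measurable_mdistl; exact: mZ.
  rewrite -[X in measurable X]setTI; have := mM measurableT (`]-oo, t[)%classic.
  rewrite (_ : M j @^-1` _ = [set s | M j s < t]); first by apply.
  by apply/seteqP; split => s; rewrite /= in_itv.
apply/seteqP; split => s /=; last first.
  move=> [j _] /= jt; have := gL (fun i => Z i s : X) (u j).
  under eq_bigr do rewrite metric_sym.
  by rewrite ler_norml /M in jt *; lra.
move=> st; set x := (fun i => Z i s : X) in st *.
pose e := (t - g x) / (2 * B * k%:R + 1).
have D0 : 0 < 2 * B * k%:R + 1 by rewrite ltr_wpDl// !mulr_ge0.
have e0 : 0 < e by rewrite divr_gt0// subr_gt0.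
have [j jx] := choice (fun i => qdense (x i) e e0).
(* The point of the dense set is chosen so close to the path that the error
   2 B k e is less than the gap t - g x. *)
exists (mkseq j k) => //; rewrite /M.
have ux (i : 'I_k) : mdist (u (mkseq j k) i) (x i) <= e.
  by rewrite metric_sym /u nth_mkseq// ltW.
have sle : \sum_(i < k) mdist (u (mkseq j k) i) (x i) <= k%:R * e.
  apply: (@le_trans _ _ (\sum_(i < k) e)); first by apply: ler_sum => i _.
  by rewrite sumr_const card_ord mulr_natl.
have := gL (u (mkseq j k)) x; rewrite ler_norml => /andP[_ h].
apply: (@le_lt_trans _ _ (g x + 2 * B * (k%:R * e))).
  have := ler_wpM2l B0 sle; rewrite /x in sle h *; lra.
have : 2 * B * (k%:R * e) + e = t - g x by rewrite /e; field; rewrite gt_eqF.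
by lra.
Qed.

Lemma measurable_lipschitz1 d (S : measurableType d) (sepX : separable_space X)
    (B : R) (g : X -> R) (Z : S -> borel X) : 0 <= B ->
  (forall x x', `|g x - g x'| <= B * mdist x x') ->
  measurable_fun setT Z -> measurable_fun setT (fun s => g (Z s : X)).
Proof.
move=> B0 gL mZ.
apply: (@measurable_lipschitz _ _ sepX 1 B (fun x => g (x 0%N)) (fun=> Z) B0) => //.
by move=> x x'; rewrite big_ord1.
Qed.

Lemma measurable_mdist d (S : measurableType d) (sepX : separable_space X)
    (f h : S -> borel X) :
  measurable_fun setT f -> measurable_fun setT h ->
  measurable_fun setT (fun s => mdist (f s : X) (h s : X)).
Proof.
move=> mf mh.
apply: (@measurable_lipschitz _ _ sepX 2 1 (fun x => mdist (x 0%N) (x 1%N))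
  (fun i => if i == 0%N then f else h)) => //.
  by move=> x x'; rewrite mul1r big_ord_recl big_ord1; exact: mdist_lipschitz.
by move=> [|i].
Qed.

Lemma measurable_borel_set1 (x : X) : measurable ([set x] : set (borel X)).
Proof.
rewrite -[[set x]]setCK; apply: measurableC; apply: sub_sigma_algebra => /=.
rewrite openE => y /= xy; rewrite /interior/=.
have e0 : 0 < mdist y x by rewrite mdist_gt0; exact/eqP.
apply: filterS (nbhsx_ballx y _ e0) => z; rewrite ballEmdist /= => yz zx.
by rewrite zx ltxx in yz.
Qed.

End lipschitz_measurability.

(** * Independence and Fubini *)

Lemma integrable_distribution {R : realType} d d' (T : measurableType d)
    (T' : measurableType d') (P : probability T R) (V : {RV P >-> T'})
    (h : T' -> \bar R) :
  (distribution P V).-integrable setT h -> P.-integrable setT (h \o V).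
Proof.
move=> /integrableP[mh hoo]; apply/integrableP; split.
  exact: (measurableT_comp mh).
by move: hoo; rewrite ge0_integral_distribution//; exact: measurableT_comp.
Qed.

(** The law of (U, V) is the product of the law of U and of Q, so that
    integrating V out first amounts to conditioning on U. *)
Section independent_pairs.
Context {R : realType} d (Omega : measurableType d) (P : probability Omega R).
Context d1 d2 (T1 : measurableType d1) (T2 : measurableType d2).
Variables (U : Omega -> T1) (V : Omega -> T2) (Q : probability T2 R).
Hypotheses (mU : measurable_fun setT U) (mV : measurable_fun setT V).
Hypothesis indepUV : forall A B, measurable A -> measurable B ->
  P (U @^-1` A `&` V @^-1` B) = P (U @^-1` A) * Q B.

Let U' : {RV P >-> T1} := mfun_Sub (mem_set mU).
Let mUV : measurable_fun setT (fun w => (U w, V w)).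
Proof. exact: measurable_fun_pair. Qed.
Let UV : {RV P >-> (T1 * T2)%type} := mfun_Sub (mem_set mUV).

Let lawUV A : measurable A -> (distribution P U' \x Q) A = distribution P UV A.
Proof. exact: product_measure_unique. Qed.

Lemma ge0_integral_indep (h : T1 * T2 -> \bar R) :
  measurable_fun setT h -> (forall z, 0 <= h z) ->
  \int[P]_w h (U w, V w) = \int[P]_w \int[Q]_v h (U w, v).
Proof.
move=> mh h0; rewrite -(ge0_integral_distribution UV)//.
rewrite (eq_measure_integral (distribution P U' \x Q)) => [|A mA _]; last first.
  by apply/esym; exact: lawUV.
rewrite fubini_tonelli1// ge0_integral_distribution//.
  exact: measurable_fun_fubini_tonelli_F.
by move=> u; exact: integral_ge0.
Qed.

Lemma integral_indep (h : T1 * T2 -> \bar R) : measurable_fun setT h ->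
  P.-integrable setT (fun w => h (U w, V w)) ->
  \int[P]_w h (U w, V w) = \int[P]_w \int[Q]_v h (U w, v).
Proof.
move=> mh ih; rewrite -(integral_distribution (X := UV))//.
rewrite (eq_measure_integral (distribution P U' \x Q)) => [|A mA _]; last first.
  by apply/esym; exact: lawUV.
have ihp : (distribution P U' \x Q).-integrable setT h.
  apply/integrableP; split => //.
  rewrite (eq_measure_integral (distribution P UV)) => [|A mA _]; last exact: lawUV.
  rewrite ge0_integral_distribution//; last exact: measurableT_comp.
  by have /integrableP[] := ih.
rewrite -integral12_prod_meas1// integral_distribution//.
  exact: (measurable_fubini_F ihp).
exact: (integrable_distribution (V := U') (integrable_fubini_F ihp)).
Qed.

End independent_pairs.

(** * The past of the chain *)

Section past.
Context {R : realType} {X Y : completeMetricType R} {d : measure_display}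
  {Omega : measurableType d} {P : probability Omega R}.
Variables (eps : nat -> {RV P >-> borel Y}) (X_ : nat -> {RV P >-> borel X}).

(** The events of a pi-system that generates the information carried by
    X_1, eps_2, ..., eps_k. *)
Definition past_cylinder (k : nat) : set (set Omega) :=
  [set E | exists2 A : set (borel X), measurable A &
           exists2 B : nat -> set (borel Y), (forall i, measurable (B i)) &
           E = X_ 1%N @^-1` A `&`
               \bigcap_(i in [set i | (2 <= i <= k)%N]) (eps i @^-1` B i)].

Lemma past_cylinder_setI k : setI_closed (past_cylinder k).
Proof.
move=> _ _ [A mA [B mB ->]] [A' mA' [B' mB' ->]].
exists (A `&` A'); first exact: measurableI.
exists (fun i => B i `&` B' i); first by move=> i; exact: measurableI.
apply/seteqP; split => [w [[wA wB] [wA' wB']]|w [[wA wA'] wB]].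
  by split => // i ik; split; [exact: wB|exact: wB'].
by do 2?split => //; move=> i /wB [].
Qed.

Lemma past_cylinder_measurable k : past_cylinder k `<=` measurable.
Proof.
move=> _ [A mA [B mB ->]]; apply: measurableI; first exact: measurable_funPTI.
by apply: bigcap_measurableType => i _; exact: measurable_funPTI.
Qed.

Lemma past_cylinderT k : past_cylinder k setT.
Proof.
exists setT => //; exists (fun=> setT) => //.
by apply/seteqP; split.
Qed.

(** The sample space with the sigma-algebra of the past up to time k. *)
Definition past (k : nat) : Type := g_sigma_algebraType (past_cylinder k).

HB.instance Definition _ k := Measurable.on (past k).

Lemma measurable_to_past k : measurable_fun setT (id : Omega -> past k).
Proof.
apply: (measurability _ (erefl : (past_cylinder k).-sigma.-measurable = <<s past_cylinder k >>)) => //.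
move=> _ [E cE <-]; rewrite setTI preimage_id.
exact: past_cylinder_measurable cE.
Qed.

Lemma past_measurable_X1 k : measurable_fun setT (X_ 1%N : past k -> borel X).
Proof.
move=> _ A mA; rewrite setTI; apply: sub_sigma_algebra.
exists A => //; exists (fun=> setT) => //.
by apply/seteqP; split=> [|w []].
Qed.

Lemma past_measurable_eps k i : (2 <= i <= k)%N ->
  measurable_fun setT (eps i : past k -> borel Y).
Proof.
move=> ik _ B mB; rewrite setTI; apply: sub_sigma_algebra.
exists setT => //; exists (fun j => if j == i then B else setT).
  by move=> j; case: ifP.
rewrite preimage_setT setTI; apply/seteqP; split => w /=.
  by move=> wB j _ /=; case: eqP => // ->.
by move=> /(_ i ik); rewrite /= eqxx.
Qed.

Variable F : borel X * borel Y -> borel X.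
Hypothesis mF : measurable_fun [set: (borel X * borel Y)%type] F.
Hypothesis X_rec : forall n w, (2 <= n)%N -> X_ n w = F (X_ n.-1 w, eps n w).

Lemma past_measurable_X k i : (i < k)%N ->
  measurable_fun setT (X_ i.+1 : past k -> borel X).
Proof.
elim: i => [_|i IH ik]; first exact: past_measurable_X1.
rewrite (_ : (X_ i.+2 : past k -> borel X) = fun w => F (X_ i.+1 w, eps i.+2 w)).
  apply: (measurableT_comp mF); apply: measurable_fun_pair; first exact: IH (ltnW ik).
  exact: past_measurable_eps.
by apply/funext => w; rewrite X_rec.
Qed.

Hypothesis eps_indep : mutually_independent P [set i | (1 <= i)%N] eps.
Hypothesis X1_indep : independent_of_family P (X_ 1%N) [set i | (2 <= i)%N] eps.

Let window (k : nat) : {fset nat} := [fset i | i in iota 2 k.-1]%fset.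

Let windowE k i : (i \in window k) = (2 <= i <= k)%N.
Proof.
rewrite /window in_fset /= mem_iota; case: k => [|k] /=; last by rewrite addnC addn2.
by case: i => [|[|[|i]]].
Qed.

Let window_set k : [set` window k] = [set i | (2 <= i <= k)%N].
Proof. by apply/seteqP; split => i /=; rewrite windowE. Qed.

Let P_cylinder k A B : measurable A -> (forall i, measurable (B i)) ->
  P (X_ 1%N @^-1` A `&` \bigcap_(i in [set` window k]) (eps i @^-1` B i)) =
  P (X_ 1%N @^-1` A) * \prod_(i <- window k) P (eps i @^-1` B i).
Proof.
move=> mA mB; rewrite X1_indep//.
  congr (_ * _); apply: eps_indep => // i; rewrite windowE => /andP[i2 _].
  exact: ltnW.
apply: (@bigcap_measurableType _ (g_sigma_algebraType _)) => i.
rewrite window_set => /= /andP[i2 _]; apply: sub_sigma_algebra.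
by exists i => //; exists (B i) => //; rewrite setTI.
Qed.

Lemma past_cylinder_indep k E B : (1 <= k)%N -> past_cylinder k E -> measurable B ->
  P (E `&` eps k.+1 @^-1` B) = P E * P (eps k.+1 @^-1` B).
Proof.
move=> k1 [A mA [D mD ->]] mB; rewrite -window_set.
have kN : k.+1 \notin window k by rewrite windowE ltnn andbF.
pose D' i := if i == k.+1 then B else D i.
have mD' i : measurable (D' i) by rewrite /D'; case: ifP.
have DE i : i \in window k -> D' i = D i.
  by move=> ik; rewrite /D' ifF//; apply: contraNF kN => /eqP <-.
have wS : window k.+1 = (k.+1 |` window k)%fset.
  apply/fsetP => i; rewrite in_fset1U !windowE; case: eqVneq => [->|ik] /=.
    by rewrite leqnn andbT ltnS.
  by rewrite (leq_eqVlt i) (negbTE ik) ltnS.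
transitivity (P (X_ 1%N @^-1` A `&` \bigcap_(i in [set` window k.+1]) (eps i @^-1` D' i))).
  congr (P _); rewrite -setIA; congr (_ `&` _); apply/seteqP; split => w /=.
    move=> [wD wB] i /=; rewrite wS in_fset1U => /orP[/eqP ->|ik].
      by rewrite /D' eqxx.
    by rewrite DE//; exact: wD.
  move=> wD; split => [i /= ik|].
    by rewrite -DE//; apply: wD; rewrite /= wS in_fset1U ik orbT.
  have := wD k.+1; rewrite /= wS in_fset1U eqxx => /(_ isT).
  by rewrite /D' eqxx.
rewrite !P_cylinder// wS big_fsetU1//= {1}/D' eqxx.
rewrite (eq_big_seq (fun i => P (eps i @^-1` D i))) => [|i ik]; last by rewrite DE.
by rewrite [in RHS]muleC [RHS]muleCA.
Qed.

(** Both sides are finite measures in E that agree on the pi-system of past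
    cylinders. *)
Lemma past_indep k (E : set (past k)) B : (1 <= k)%N -> measurable E ->
  measurable B -> P (E `&` eps k.+1 @^-1` B) = P E * P (eps k.+1 @^-1` B).
Proof.
move=> k1 mE mB; rewrite (muleC (P E)).
have mV : measurable (eps k.+1 @^-1` B) by exact: measurable_funPTI.
have p0 : (0 <= fine (P (eps k.+1 @^-1` B)))%R by rewrite fine_ge0.
pose m2 := mscale (NngNum p0) P.
have m2E A : m2 A = P (eps k.+1 @^-1` B) * P A.
  by rewrite /m2 /mscale /= fineK// fin_num_measure.
transitivity (m2 E) => //.
apply: (g_sigma_algebra_measure_unique (past_cylinder k) _ (fun=> setT) _ _
    (mrestr P mV)) => //.
- exact: past_cylinder_measurable.
- by move=> _; exact: past_cylinderT.
- by rewrite bigcup_const//; exists 0%N.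
- exact: past_cylinder_setI.
- by move=> A cA; rewrite /= /mrestr past_cylinder_indep// muleC.
- by move=> _; rewrite /= /mrestr setTI -ge0_fin_numE// fin_num_measure.
Qed.

End past.

(** * Image measures *)

Section image_measures.
Context {R : realType} d d' {T : measurableType d} {T' : measurableType d'}.

Definition image_measure (m : {measure set T -> \bar R}) (f : T -> T')
    (mf : measurable_fun setT f) : {measure set T' -> \bar R} :=
  measure_function_pushforward__canonical__measure_function_Measure m mf.

Lemma image_measureE m f (mf : measurable_fun setT f) A :
  image_measure m mf A = m (f @^-1` A).
Proof. by []. Qed.

Lemma ge0_integral_image m f (mf : measurable_fun setT f) (h : T' -> \bar R) :
  measurable_fun setT h -> (forall x, 0 <= h x) ->
  \int[image_measure m mf]_y h y = \int[m]_x h (f x).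
Proof. by move=> mh h0; rewrite ge0_integral_pushforward. Qed.

Lemma ge0_integral_mrestr (m : {measure set T -> \bar R}) D (mD : measurable D)
    (h : T -> \bar R) : measurable_fun setT h -> (forall x, 0 <= h x) ->
  \int[mrestr m mD]_x h x = \int[m]_x (h x * (\1_D x)%:E).
Proof.
move=> mh h0; have mDC : measurable (~` D) by exact: measurableC.
rewrite -[in LHS](setUv D) ge0_integral_setU ?setUv//=; last exact/disj_setPCl.
rewrite [X in _ + X]null_set_integral//; [|exact: measurable_funTS|]; last first.
  by rewrite /= /mrestr setICl measure0.
rewrite adde0 [LHS](eq_measure_integral m) => [|A mA AD]; last first.
  rewrite /= /mrestr. by rewrite setIidl.
rewrite integral_mkcond.
by apply: eq_integral => x _; rewrite epatch_indic.
Qed.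

Lemma mnormalize_mass1 (m : {measure set T -> \bar R}) (P : probability T R) A :
  m setT = 1 -> mnormalize m P A = m A.
Proof. by move=> m1; rewrite /mnormalize m1 /= onee_eq0 /= invr1 mule1. Qed.

Lemma integral_cst_probability (P : probability T R) (r : \bar R) :
  \int[P]_x cst r x = r.
Proof. by rewrite integral_cst// [X in _ * X](_ : _ = 1) ?mule1//; exact: probability_setT. Qed.

End image_measures.

(** * Wasserstein distance from an empirical distribution *)

Section wasserstein_empirical.
Context {R : realType} {X : completeMetricType R}.
Hypothesis sepX : separable_space X.
Variable mu : probability (borel X) R.
Variables (n : nat) (n_gt0 : (0 < n)%N).
Implicit Types (x : nat -> X) (nu : nat -> {measure set (borel X) -> \bar R}).

(** The measures nu_i describe a coupling of the empirical distribution and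
    mu: nu_i is where the mass 1/n attached to the i-th point is sent.  This
    description does not refer to the positions of the points, so it can be
    carried over from one path to another. *)
Definition mass_split nu : Prop :=
  (forall A, measurable A -> \sum_(i < n) nu i A = mu A) /\
  (forall i, (i < n)%N -> nu i setT = (n%:R^-1)%:E).

Definition transport_cost x nu : \bar R :=
  \sum_(i < n) \int[nu i]_z (mdist (x i.+1) (z : X))%:E.

Lemma empiricalE x A : empirical x n A =
  (n%:R^-1)%:E * \sum_(i < n) (\d_(x i.+1 : borel X) A : \bar R).
Proof. by []. Qed.

Let mdist_ge0E (a b : X) : 0 <= (mdist a b)%:E.
Proof. by rewrite lee_fin mdist_ge0. Qed.

Let measurable_cost : measurable_fun [set: (borel X * borel X)%type]
  (fun z => (mdist (z.1 : X) (z.2 : X))%:E).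
Proof. by apply/measurable_EFinP; exact: measurable_mdist. Qed.

Let measurable_cost1 (a : X) :
  measurable_fun [set: borel X] (fun z => (mdist a (z : X))%:E).
Proof. by apply/measurable_EFinP; exact: measurable_mdistl. Qed.

Let measurable_pair_with (a : borel X) : measurable_fun setT (fun z : borel X => (a, z)).
Proof. exact: measurable_fun_pair. Qed.

(** The sum of the images of nu_i by z |-> (x_i, z) is a coupling. *)
Lemma W1_le_transport_cost x nu : mass_split nu ->
  W1 (empirical x n) mu <= transport_cost x nu.
Proof.
move=> [nuE nu1].
pose m := msum (fun i => image_measure (nu i) (measurable_pair_with (x i.+1))) n.
have mE A : m A = \sum_(i < n) nu i [set z | A (x i.+1 : borel X, z)] by [].
have m1 A : measurable A -> m (A `*` setT) = empirical x n A.
  move=> mA; rewrite mE empiricalE ge0_sume_distrr; last by move=> i _; exact: measure_ge0.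
  apply: eq_bigr => i _; rewrite diracE.
  have [xA|xA] := boolP ((x i.+1 : borel X) \in A).
    rewrite mule1 -(nu1 i)//; congr (nu i _); apply/seteqP; split => //= z _.
    by split => //; exact/set_mem.
  rewrite mule0 (_ : [set z | _] = set0) ?measure0//; apply/seteqP; split => //= z [xA' _].
  by move: xA; rewrite mem_set.
have m2 A : measurable A -> m (setT `*` A) = mu A.
  move=> mA; rewrite mE -nuE//; apply: eq_bigr => i _; congr (nu i _).
  by apply/seteqP; split => z //= -[].
have mT : m setT = 1 by rewrite -setXTT m2// probability_setT.
pose lambda : probability (borel X * borel X)%type R := mnormalize m point.
have lE A : lambda A = m A by exact: mnormalize_mass1.
apply: ge_ereal_inf; exists (\int[lambda]_z (mdist (z.1 : X) (z.2 : X))%:E).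
  by exists lambda => // A mA; rewrite !lE m1// m2.
rewrite (eq_measure_integral m) => [|A _ _]; last exact: lE.
rewrite ge0_integral_measure_sum//; apply: lee_sum => i _.
by rewrite ge0_integral_image.
Qed.

(** The part of lambda above the point x_i is divided equally among the indices
    j with x_j = x_i.  The marginal on mu needs no almost sure argument: nu_int
    gives one inequality, and applied to the complement it gives the other one
    because both total masses are 1. *)
Lemma coupling_mass_split x (lambda : probability (borel X * borel X)%type R) :
  couplings (empirical x n) mu lambda ->
  exists2 nu, mass_split nu &
    transport_cost x nu <= \int[lambda]_z (mdist (z.1 : X) (z.2 : X))%:E.
Proof.
move=> cpl.
(* the number of indices whose point is a *)
pose mult (a : X) : R := (\sum_(j < n) (x j.+1 == a)%:R)%R.
have mult_ge0 a : (0 <= mult a)%R by rewrite sumr_ge0.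
have mult_gt0 i : (i < n)%N -> (0 < mult (x i.+1))%R.
  move=> ik; rewrite /mult (bigD1 (Ordinal ik))//= eqxx ltr_pwDl// sumr_ge0//.
have mult0 i : (0 <= (mult (x i.+1))^-1)%R by rewrite invr_ge0.
have mfib a : measurable ([set a] `*` setT : set (borel X * borel X)).
  by apply: measurableX => //; exact: measurable_borel_set1.
have msnd : measurable_fun setT (snd : borel X * borel X -> borel X) by [].
pose nu i : {measure set (borel X) -> \bar R} :=
  mscale (NngNum (mult0 i)) (image_measure (mrestr lambda (mfib (x i.+1))) msnd).
have nu_int (h : borel X * borel X -> \bar R) : measurable_fun setT h ->
    (forall z, 0 <= h z) ->
    \sum_(i < n) \int[nu i]_z h (x i.+1 : borel X, z) <= \int[lambda]_z h z.
  move=> mh h0.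
  have mhx a : measurable_fun setT (fun z => h (a : borel X, z)).
    by apply: (measurableT_comp mh); exact: measurable_pair_with.
  have hx0 i z : (0 <= ((mult (x i.+1))^-1 * \1_([set x i.+1] `*` setT) (z : borel X * borel X)))%R.
    by rewrite mulr_ge0.
  under eq_bigr => i _.
    rewrite ge0_integral_mscale//= ge0_integral_image//.
    rewrite ge0_integral_mrestr//; last exact: (measurableT_comp (mhx _)).
    rewrite -ge0_integralZl_EFin//; last 2 first.
      by move=> z _; rewrite mule_ge0// lee_fin.
      apply: emeasurable_funM; first exact: (measurableT_comp (mhx _)).
      by apply/measurable_EFinP; exact: measurable_indic.
    rewrite (eq_integral (fun z : (borel X * borel X)%type => ((mult (x i.+1))^-1 *
        \1_([set x i.+1] `*` setT) z)%:E * h z)) => [|z _]; last first.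
      rewrite /= EFinM -muleA; congr (_ * _); rewrite muleC.
      case: z => z1 z2; rewrite indicE.
      by have [/set_mem/= [-> _]//|_] := boolP ((z1, z2) \in _); rewrite !mul0e.
    over.
  rewrite -ge0_integral_sum//; last 2 first.
    move=> i; apply: emeasurable_funM => //.
    by apply/measurable_EFinP/measurable_funM => //; exact: measurable_indic.
    by move=> i z _; rewrite mule_ge0// lee_fin.
  apply: ge0_le_integral => //.
    by move=> z _; rewrite sume_ge0// => i _; rewrite mule_ge0// lee_fin.
    apply: emeasurable_sum => i; apply: emeasurable_funM => //.
    by apply/measurable_EFinP/measurable_funM => //; exact: measurable_indic.
  move=> [a b] _; rewrite -ge0_sume_distrl; last by move=> i _; rewrite lee_fin.
  rewrite -[leRHS]mul1e; apply: lee_wpmul2r => //.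
  rewrite sumEFin lee_fin.
  have sE : (\sum_(i < n) (mult (x i.+1))^-1 * \1_([set x i.+1] `*` setT) (a, b) =
      (mult a)^-1 * mult a)%R.
    rewrite /mult mulr_sumr; apply: eq_bigr => i _; rewrite indicE.
    case: eqVneq => [->|xa].
      by rewrite mem_set.
    by rewrite memNset ?mulr0// => -[/= ax _]; rewrite ax eqxx in xa.
  rewrite sE; have [->|m0] := eqVneq (mult a) 0%R; first by rewrite mulr0.
  by rewrite mulVf.
have nuT i : (i < n)%N -> nu i setT = (n%:R^-1)%:E.
  move=> ik; rewrite /nu /= /mscale image_measureE /= /mrestr preimage_setT setTI.
  have [-> _] := cpl _ (measurable_borel_set1 (x i.+1)).
  rewrite empiricalE.
  under eq_bigr do rewrite diracE in_set1.
  rewrite sumEFin -!EFinM; congr (_%:E).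
  rewrite mulrCA -/(mult _) mulVf ?mulr1// gt_eqF//; exact: mult_gt0.
have nu_le A : measurable A -> \sum_(i < n) nu i A <= mu A.
  move=> mA; have [_ <-] := cpl _ mA.
  have mSA : measurable ([set: borel X] `*` A) by exact: measurableX.
  have mind : measurable_fun setT (fun z : borel X * borel X => (\1_A z.2)%:E : \bar R).
    apply/measurable_EFinP.
    exact: (@measurableT_comp _ _ _ _ _ _ (\1_A : borel X -> R)).
  apply: (@le_trans _ _ (\int[lambda]_z (\1_([set: borel X] `*` A) z)%:E)); last first.
    by rewrite integral_indic// setIT.
  rewrite (eq_integral (fun z : (borel X * borel X)%type => (\1_A z.2)%:E)) => [|z _].
    apply: le_trans (nu_int _ mind _); last by move=> z; rewrite lee_fin.
    by apply: lee_sum => i _; rewrite integral_indic// setIT.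
  by case: z => z1 z2; rewrite !indicE in_setX in_setT.
exists nu; last by apply: nu_int.
split => // A mA; apply/eqP; rewrite eq_le nu_le//=.
have mAC : measurable (~` A) by exact: measurableC.
have tot : \sum_(i < n) nu i A + \sum_(i < n) nu i (~` A) = 1.
  rewrite -big_split (eq_bigr (fun=> (n%:R^-1)%:E)) => [|i _]; last first.
    by rewrite /= -measureU ?setICr// setUv; exact: nuT.
  by rewrite sumEFin sumr_const card_ord -[(_ *+ n)%R]mulr_natl mulfV// pnatr_eq0 -lt0n.
have fs B : measurable B -> \sum_(i < n) nu i B \is a fin_num.
  move=> mB; rewrite ge0_fin_numE; last by rewrite sume_ge0.
  by apply: (le_lt_trans (nu_le _ mB)); rewrite -ge0_fin_numE// fin_num_measure.
have -> : mu A = 1 - mu (~` A) by rewrite -probability_setC// setCK.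
by rewrite -tot leeBlDr ?fin_num_measure// leeD2l// nu_le.
Qed.

(** A mass splitting for x is also one for x', and its cost changes by at most
    the mass 1/n times the displacement of each point. *)
Lemma W1_lipschitz x x' :
  W1 (empirical x' n) mu <= W1 (empirical x n) mu +
    (n%:R^-1 * \sum_(i < n) mdist (x i.+1) (x' i.+1))%:E.
Proof.
rewrite -leeBlDr//; apply: le_ereal_inf_tmp => _ [lambda cpl <-].
rewrite leeBlDr//; have [nu nuS nule] := coupling_mass_split cpl.
apply: (le_trans (W1_le_transport_cost x' nuS)).
apply: (@le_trans _ _ (transport_cost x nu +
    (n%:R^-1 * \sum_(i < n) mdist (x i.+1) (x' i.+1))%:E)); last exact: leeD2r.
rewrite /transport_cost mulr_sumr -sumEFin -big_split/=.
apply: lee_sum => i _.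
have [_ /(_ i (ltn_ord i)) nui] := nuS.
rewrite mulrC EFinM -nui -integral_cst// -ge0_integralD//; last first.
  by move=> z _; exact: mdist_ge0E.
apply: ge0_le_integral => //.
- by apply: emeasurable_funD => //; exact: measurable_cost1.
- move=> z _; rewrite -EFinD lee_fin.
  by rewrite addrC (metric_sym (x i.+1) (x' i.+1)) metric_triangle.
Qed.

Lemma W1_ge0 x : 0 <= W1 (empirical x n) mu.
Proof.
by apply: le_ereal_inf_tmp => _ [lambda _ <-]; apply: integral_ge0 => z _.
Qed.

Hypothesis mu_moment : exists x0 : X, \int[mu]_z (mdist x0 (z : X))%:E < +oo.

Lemma W1_fin_num x : W1 (empirical x n) mu \is a fin_num.
Proof.
have [x0 mx0] := mu_moment.
rewrite ge0_fin_numE ?W1_ge0//.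
have n0 : (0 <= n%:R^-1 :> R)%R by rewrite invr_ge0.
pose nu (i : nat) : {measure set (borel X) -> \bar R} := mscale (NngNum n0) mu.
have nuE i A : nu i A = (n%:R^-1)%:E * mu A by [].
have nuS : mass_split nu.
  split => [A mA|i _]; last by rewrite nuE probability_setT mule1.
  under eq_bigr do rewrite nuE.
  rewrite -ge0_sume_distrl; last by move=> i _; rewrite lee_fin.
  rewrite sumEFin sumr_const card_ord -[(_ *+ n)%R]mulr_natl mulfV ?mul1e//.
  by rewrite pnatr_eq0 -lt0n.
apply: (le_lt_trans (W1_le_transport_cost x nuS)).
apply: lte_sum_pinfty => i _.
rewrite ge0_integral_mscale//.
apply: lte_mul_pinfty; rewrite ?lee_fin//.
apply: (@le_lt_trans _ _ (\int[mu]_z ((mdist (x i.+1) x0)%:E + (mdist x0 (z : X))%:E))).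
  apply: ge0_le_integral => //.
  - by apply: emeasurable_funD => //; exact: measurable_cost1.
  - by move=> z _; rewrite -EFinD lee_fin metric_triangle.
rewrite ge0_integralD// integral_cst//.
apply: lte_add_pinfty => //; apply: lte_mul_pinfty => //.
by rewrite -ge0_fin_numE// fin_num_measure.
Qed.

End wasserstein_empirical.

(** * First moment of the invariant distribution *)

Section invariant_moment.
Context {R : realType} {X Y : completeMetricType R}.
Hypotheses (sepX : separable_space X) (sepY : separable_space Y).
Variables (mu : probability (borel X) R) (Q : probability (borel Y) R).
Variable F : borel X * borel Y -> borel X.
Hypothesis mF : measurable_fun [set: (borel X * borel Y)%type] F.
Variables (rho C : R).
Hypotheses (rho_ge0 : (0 <= rho)%R) (rho_lt1 : (rho < 1)%R) (C_gt0 : (0 < C)%R).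
Hypothesis contract : forall x x' : X,
  \int[Q]_y (mdist (F (x, y) : X) (F (x', y) : X))%:E <= (rho * mdist x x')%:E.
Hypothesis F_lip : forall (x : X) (y y' : Y),
  (mdist (F (x, y) : X) (F (x, y') : X) <= C * mdist y y')%R.
Hypothesis invariant : forall A : set (borel X), measurable A ->
  \int[mu]_x Q ((fun y => F (x, y)) @^-1` A) = mu A.
Variable y0 : Y.
Hypothesis noise_moment : \int[Q]_y (mdist y0 (y : Y))%:E < +oo.

Lemma measurable_section (x : borel X) : measurable_fun setT (fun y => F (x, y)).
Proof. by apply: (measurableT_comp mF); exact: measurable_fun_pair. Qed.

Lemma measurable_noise_mdist (x z : X) :
  measurable_fun [set: borel Y] (fun y => (mdist z (F (x, y) : X))%:E).
Proof.
by apply/measurable_EFinP; apply: measurable_mdistl; exact: measurable_section.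
Qed.

Lemma noise_mdist_finite (x z : X) : \int[Q]_y (mdist z (F (x, y) : X))%:E < +oo.
Proof.
have mc : measurable_fun [set: borel Y] (fun y => (mdist y0 (y : Y))%:E).
  by apply/measurable_EFinP; exact: measurable_mdistl.
have c0 y : 0 <= (mdist y0 (y : Y))%:E by rewrite lee_fin mdist_ge0.
apply: (@le_lt_trans _ _ (\int[Q]_y ((mdist z (F (x, y0) : X))%:E +
    C%:E * (mdist y0 (y : Y))%:E))).
  apply: ge0_le_integral => //.
  - by move=> y _; rewrite lee_fin mdist_ge0.
  - exact: measurable_noise_mdist.
  - by apply: emeasurable_funD => //; exact: measurable_funeM.
  - move=> y _; rewrite -EFinM -EFinD lee_fin.
    by apply: (le_trans (metric_triangle _ (F (x, y0) : X) _)); rewrite lerD2l F_lip.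
rewrite ge0_integralD//; last 3 first.
- by move=> y _; rewrite lee_fin mdist_ge0.
- by move=> y _; rewrite mule_ge0// lee_fin ltW.
- exact: measurable_funeM.
rewrite integral_cst// ge0_integralZl_EFin//; last exact: ltW.
apply: lte_add_pinfty; last by apply: lte_mul_pinfty => //; rewrite lee_fin ltW.
apply: lte_mul_pinfty => //; first by rewrite lee_fin mdist_ge0.
by rewrite -ge0_fin_numE// fin_num_measure.
Qed.

(** Invariance says that mu is the image by F of mu times the noise law. *)
Lemma ge0_integral_invariant (h : borel X -> \bar R) :
  measurable_fun setT h -> (forall x, 0 <= h x) ->
  \int[mu]_x h x = \int[mu]_x \int[Q]_y h (F (x, y)).
Proof.
move=> mh h0.
have mhF : measurable_fun setT (h \o F) by exact: (measurableT_comp mh).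
have hF0 z : 0 <= (h \o F) z by exact: h0.
transitivity (\int[mu \x Q]_z (h \o F) z); last by rewrite fubini_tonelli1.
rewrite -[RHS](ge0_integral_image _ mF)//; apply: eq_measure_integral => A mA _.
rewrite -[LHS](invariant mA); apply: eq_integral => x _ /=; congr (Q _).
by apply/seteqP; split => y; rewrite /xsection /= inE.
Qed.

(** The function V = d(x0, .) satisfies the drift inequality KV <= rho V + b for
    the kernel K of the chain.  As the integral of V may be infinite a priori,
    V is first truncated at M: invariance gives
    mu(min(V, M)) <= mu(min(rho V + b, M)), both sides finite, hence
    mu((1 - rho) V 1_{V <= M}) <= b, and M tends to infinity. *)
Lemma invariant_moment (x0 : X) : \int[mu]_z (mdist x0 (z : X))%:E < +oo.
Proof.
pose V (z : borel X) : R := mdist x0 (z : X).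
have V0 z : (0 <= V z)%R by exact: mdist_ge0.
have mV : measurable_fun setT V by exact: measurable_mdistl.
set be := \int[Q]_y (V (F (x0, y)))%:E.
have be0 : 0 <= be by apply: integral_ge0 => y _; rewrite lee_fin.
have befin : be \is a fin_num by rewrite ge0_fin_numE// noise_mdist_finite.
pose b : R := fine be.
have b0 : (0 <= b)%R by exact: fine_ge0.
have bE : be = b%:E by rewrite fineK.
have drift x : \int[Q]_y (V (F (x, y)))%:E <= (rho * V x + b)%:E.
  rewrite EFinD -bE.
  apply: (@le_trans _ _ (\int[Q]_y ((mdist (F (x, y) : X) (F (x0, y) : X))%:E + (V (F (x0, y)))%:E))).
    apply: ge0_le_integral => //.
    - by move=> y _; rewrite lee_fin.
    - exact: measurable_noise_mdist.
    - apply: emeasurable_funD; last exact: measurable_noise_mdist.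
      by apply/measurable_EFinP; apply: measurable_mdist => //; exact: measurable_section.
    - move=> y _; rewrite -EFinD lee_fin addrC /V.
      by rewrite (metric_sym (F (x, y) : X)) metric_triangle.
  rewrite ge0_integralD//; last 4 first.
  - by move=> y _; rewrite lee_fin mdist_ge0.
  - by apply/measurable_EFinP; apply: measurable_mdist => //; exact: measurable_section.
  - by move=> y _; rewrite lee_fin.
  - exact: measurable_noise_mdist.
  by apply: leeD2r; apply: (le_trans (contract _ _)); rewrite /V metric_sym.
pose cap (M : nat) z : R := Num.min (V z) M%:R.
pose dcap (M : nat) z : R := Num.min (rho * V z + b)%R M%:R.
have mcap M : measurable_fun setT (cap M) by exact: measurable_minr.
have mdcap M : measurable_fun setT (dcap M).
  by apply: measurable_minr => //; apply: measurable_funD => //; exact: measurable_funM.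
have cap0 M z : (0 <= cap M z)%R by rewrite le_min V0 ler0n.
have dcap0 M z : (0 <= dcap M z)%R by rewrite le_min ler0n addr_ge0// mulr_ge0.
have cap_le M : \int[mu]_z (cap M z)%:E <= \int[mu]_z (dcap M z)%:E.
  rewrite (@ge0_integral_invariant (fun z => (cap M z)%:E)); last 2 first.
    exact/measurable_EFinP.
    by move=> z; rewrite lee_fin.
  have mcF x : measurable_fun setT (fun y => (cap M (F (x, y)))%:E).
    by apply/measurable_EFinP; apply: (measurableT_comp (mcap M)); exact: measurable_section.
  apply: ge0_le_integral => //.
  - by move=> z _; apply: integral_ge0 => y _; rewrite lee_fin.
  - apply: (measurable_fun_fubini_tonelli_F (fun z => (cap M (F z))%:E)).
      by apply/measurable_EFinP; exact: (measurableT_comp (mcap M)).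
    by move=> z; rewrite lee_fin.
  - exact/measurable_EFinP.
  - move=> x _; rewrite EFin_min le_min; apply/andP; split.
      apply: le_trans (drift x); apply: ge0_le_integral => //.
      + by move=> y _; rewrite lee_fin.
      + exact: measurable_noise_mdist.
      + by move=> y _; rewrite lee_fin ge_min lexx.
    apply: (@le_trans _ _ (\int[Q]_y (cst M%:R%:E y))).
      apply: ge0_le_integral => //; first by move=> y _; rewrite lee_fin.
      by move=> y _; rewrite lee_fin ge_min lexx orbT.
    by rewrite integral_cst_probability.
have dcap_fin M : \int[mu]_z (dcap M z)%:E \is a fin_num.
  rewrite ge0_fin_numE; last by apply: integral_ge0 => z _; rewrite lee_fin.
  apply: (@le_lt_trans _ _ (\int[mu]_y (cst M%:R%:E y))).
    apply: ge0_le_integral => //; first by move=> y _; rewrite lee_fin.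
      exact/measurable_EFinP.
    by move=> y _; rewrite lee_fin ge_min lexx orbT.
  by rewrite integral_cst_probability ltry.
pose v (M : nat) (z : borel X) : R := ((1 - rho) * (V z * \1_[set z | V z <= M%:R]%R z))%R.
have v0 M z : (0 <= v M z)%R by rewrite !mulr_ge0// subr_ge0 ltW.
have mv M : measurable_fun setT (v M).
  apply: measurable_funM => //; apply: measurable_funM => //.
  apply: measurable_indic.
  have := measurable_fun_ler mV (measurable_cst (M%:R : R)).
  by move=> /(_ measurableT [set true]); rewrite setTI; apply.
have v_le M z : (v M z + dcap M z <= cap M z + b)%R.
  rewrite /v /dcap /cap indicE; have Vz := V0 z.
  have [Vz1|Vz1] := leP (V z) M%:R.
    rewrite mem_set// mulr1.
    have : (Num.min (rho * V z + b) M%:R <= rho * V z + b)%R by rewrite ge_min lexx.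
    by move: (Num.min _ _) => t; lra.
  rewrite memNset ?mulr0 ?add0r; last by apply/negP; rewrite -ltNge.
  have : (Num.min (rho * V z + b) M%:R <= M%:R)%R by rewrite ge_min lexx orbT.
  by move: (Num.min _ _) => t; lra.
have v_int M : \int[mu]_z (v M z)%:E <= b%:E.
  rewrite -(leeD2rE _ _ (dcap_fin M)) -ge0_integralD//; last 4 first.
  - by move=> z _; rewrite lee_fin.
  - exact/measurable_EFinP.
  - by move=> z _; rewrite lee_fin.
  - exact/measurable_EFinP.
  apply: (@le_trans _ _ (\int[mu]_z ((cap M z)%:E + cst b%:E z))).
    apply: ge0_le_integral => //.
    - by move=> z _; rewrite adde_ge0// lee_fin.
    - by apply: emeasurable_funD; exact/measurable_EFinP.
    - by apply: emeasurable_funD => //; exact/measurable_EFinP.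
    - by move=> z _; rewrite -!EFinD lee_fin.
  rewrite ge0_integralD//; last 2 first.
  - by move=> z _; rewrite lee_fin.
  - exact/measurable_EFinP.
  by rewrite integral_cst_probability addeC leeD2l.
have lim_v z : limn (fun M => (v M z)%:E) = ((1 - rho) * V z)%:E.
  apply/cvg_lim => //; apply: cvg_near_cst.
  near=> M; rewrite /v indicE mem_set ?mulr1//=.
  by near: M; exact: nbhs_infty_ger.
have : \int[mu]_z ((1 - rho) * V z)%:E <= b%:E.
  under eq_integral do rewrite -lim_v.
  rewrite monotone_convergence//; last 3 first.
  - by move=> M; exact/measurable_EFinP.
  - by move=> M z _; rewrite lee_fin.
  - move=> z _ M N MN; rewrite lee_fin /v ler_wpM2l//; first by rewrite subr_ge0 ltW.
    rewrite ler_wpM2l// !indicE.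
    have [/set_mem /= VM|_] := boolP (z \in _); last by rewrite ler0n.
    by rewrite mem_set//= (le_trans VM)// ler_nat.
  apply: lime_le; last by near=> M; exact: v_int.
  apply: ereal_nondecreasing_is_cvgn => M N MN; apply: ge0_le_integral => //.
  - by move=> z _; rewrite lee_fin.
  - exact/measurable_EFinP.
  - exact/measurable_EFinP.
  - move=> z _; rewrite lee_fin /v ler_wpM2l//; first by rewrite subr_ge0 ltW.
    rewrite ler_wpM2l// !indicE.
    have [/set_mem /= VM|_] := boolP (z \in _); last by rewrite ler0n.
    by rewrite mem_set//= (le_trans VM)// ler_nat.
under eq_integral do rewrite EFinM.
rewrite ge0_integralZl_EFin//; last 3 first.
- by move=> z _; rewrite lee_fin.
- exact/measurable_EFinP.
- by rewrite subr_ge0 ltW.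
rewrite -lee_pdivlMl; last by rewrite subr_gt0.
by move=> h; apply: (le_lt_trans h); rewrite ltry.
Unshelve. all: by end_near. Qed.

End invariant_moment.

(** * Moments of an increment *)

Section one_step.
Context {R : realType} d {T : measurableType d}.
Variable nu : probability T R.

Lemma integrable_oscillation (h : T -> R) (D : T -> T -> R) (y0 : T) :
  measurable_fun setT h -> (forall y, measurable_fun setT (D y)) ->
  (forall y y', (`|h y - h y'| <= D y y')%R) ->
  \int[nu]_y (D y0 y)%:E < +oo ->
  nu.-integrable setT (fun y => (h y)%:E).
Proof.
move=> mh mD hD Dfin.
have D0 y y' : (0 <= D y y')%R by apply: le_trans (hD y y').
apply: (@le_integrable _ _ _ _ _ measurableT _ (fun y => (`|h y0|)%:E + (D y0 y)%:E)).
- exact/measurable_EFinP.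
- move=> y _; rewrite -EFinD !abse_EFin lee_fin [leRHS]ger0_norm ?addr_ge0//.
  have := hD y0 y; have := ler_normB (h y0) (h y0 - h y)%R.
  by rewrite subKr; lra.
- apply: integrableD => //; first exact: finite_measure_integrable_cst.
  apply/integrableP; split; first exact/measurable_EFinP.
  by under eq_integral do rewrite abse_EFin ger0_norm//.
Qed.

(** h(y) - E h = E (h(y) - h). *)
Lemma mean_oscillation (h : T -> R) (D : T -> T -> R) (y : T) :
  measurable_fun setT h -> (forall y, measurable_fun setT (D y)) ->
  (forall y y', (`|h y - h y'| <= D y y')%R) ->
  nu.-integrable setT (fun y => (h y)%:E) ->
  (`|h y - fine (\int[nu]_y' (h y')%:E)|)%:E <= \int[nu]_y' (D y y')%:E.
Proof.
move=> mh mD hD ih.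
have icst : nu.-integrable setT (cst (h y)%:E) by exact: finite_measure_integrable_cst.
have mb : measurable_fun setT (fun y' => (h y - h y')%R) by exact: measurable_funB.
have -> : (`|h y - fine (\int[nu]_y' (h y')%:E)|)%:E = `| \int[nu]_y' (h y - h y')%:E |.
  under [in RHS]eq_integral do rewrite EFinB.
  rewrite integralB// integral_cst_probability -abse_EFin EFinB fineK//.
  exact: integrable_fin_num.
apply: le_trans (le_abse_integral _ _ _) _ => //; first exact/measurable_EFinP.
apply: ge0_le_integral => //.
- by apply/measurableT_comp => //; exact/measurable_EFinP.
- exact/measurable_EFinP.
- by move=> y' _; rewrite abse_EFin lee_fin.
Qed.

Variables (p kap L : R).
Hypotheses (p_gt0 : (0 < p)%R) (kap_ge0 : (0 <= kap)%R) (L_ge0 : (0 <= L)%R).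
Hypothesis smooth : forall a b : R, (`|a + b| `^ p <=
  (1 + kap) * `|a| `^ p + powR_slope p a * b + L * `|b| `^ p)%R.

(** The smoothness inequality is applied to E h - m and h - E h; after
    integration its linear term disappears, since its slope is a constant and
    h - E h is centered. *)
Lemma moment_step (h : T -> R) (m K : R) :
  measurable_fun setT h -> nu.-integrable setT (fun y => (h y)%:E) ->
  let hm := fine (\int[nu]_y (h y)%:E) in
  \int[nu]_y (`|h y - hm| `^ p)%:E <= K%:E ->
  \int[nu]_y (`|h y - m| `^ p)%:E <= ((1 + kap) * `|hm - m| `^ p + L * K)%:E.
Proof.
move=> mh ih hm hK.
have mpow c : measurable_fun setT (fun y => (`|h y - c| `^ p)%:E).
  apply/measurable_EFinP; apply: (measurableT_comp (measurable_powR p)).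
  by apply: measurableT_comp => //; exact: measurable_funB.
have ipow : nu.-integrable setT (fun y => (`|h y - hm| `^ p)%:E).
  apply/integrableP; split; first exact: mpow.
  under eq_integral do rewrite abse_EFin ger0_norm ?powR_ge0//.
  by apply: (le_lt_trans hK); rewrite ltry.
set s := powR_slope p (hm - m).
have icst c : nu.-integrable setT (fun=> c%:E) by exact: finite_measure_integrable_cst.
have ilin : nu.-integrable setT (fun y => s%:E * ((h y)%:E - hm%:E)).
  by apply: integrableZl => //; exact: integrableB.
have hmE : \int[nu]_y (h y)%:E = hm%:E by rewrite fineK//; exact: integrable_fin_num.
apply: (@le_trans _ _ (\int[nu]_y (cst ((1 + kap) * `|hm - m| `^ p)%:E y +
    s%:E * ((h y)%:E - hm%:E) + L%:E * (`|h y - hm| `^ p)%:E))).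
  have e y : cst ((1 + kap) * `|hm - m| `^ p)%:E y + s%:E * ((h y)%:E - hm%:E) +
      L%:E * (`|h y - hm| `^ p)%:E =
      ((1 + kap) * `|hm - m| `^ p + s * (h y - hm) + L * `|h y - hm| `^ p)%:E.
    by rewrite /cst -EFinB -!EFinM -!EFinD.
  have le y : (`|h y - m| `^ p <=
      (1 + kap) * `|hm - m| `^ p + s * (h y - hm) + L * `|h y - hm| `^ p)%R.
    by have := smooth (hm - m) (h y - hm); rewrite addrC addrA subrK.
  apply: ge0_le_integral => //.
  - apply: emeasurable_funD; last by apply: measurable_funeM; exact: mpow.
    by apply: emeasurable_funD => //; exact: measurable_int ilin.
  - by move=> y _; rewrite e lee_fin.
rewrite integralD//; last 2 first.
- by apply: integrableD => //; exact: icst.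
- exact: integrableZl.
rewrite integralD//; last exact: icst.
rewrite integral_cst_probability integralZl//; last by apply: integrableB.
rewrite integralB// hmE (integral_cst_probability nu hm%:E) subee// mule0 adde0.
rewrite integralZl// EFinD leeD2lE// EFinM.
by apply: lee_wpmul2l; rewrite ?lee_fin.
Qed.

Lemma oscillation_moment (h G : T -> R) (D : T -> T -> R) (B A : R) :
  measurable_fun setT h -> (forall y, measurable_fun setT (D y)) ->
  (forall y y', (`|h y - h y'| <= D y y')%R) ->
  nu.-integrable setT (fun y => (h y)%:E) ->
  measurable_fun setT G -> (forall y, (0 <= G y)%R) -> (0 <= B)%R ->
  (forall y, \int[nu]_y' (D y y')%:E = (B * G y)%:E) ->
  \int[nu]_y (G y `^ p)%:E <= A%:E ->
  \int[nu]_y (`|h y - fine (\int[nu]_y' (h y')%:E)| `^ p)%:E <= (B `^ p * A)%:E.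
Proof.
move=> mh mD hD ih mG G0 B0 DG GA; set hm := fine _.
have mGp : measurable_fun setT (fun y => (G y `^ p)%:E).
  by apply/measurable_EFinP; exact: (measurableT_comp (measurable_powR p)).
apply: (@le_trans _ _ (\int[nu]_y ((B `^ p)%:E * (G y `^ p)%:E))).
  apply: ge0_le_integral => //.
  - apply/measurable_EFinP; apply: (measurableT_comp (measurable_powR p)).
    by apply: measurableT_comp => //; exact: measurable_funB.
  - exact: measurable_funeM.
  - move=> y _; rewrite -EFinM lee_fin -powRM//.
    apply: ge0_ler_powR; rewrite ?nnegrE ?mulr_ge0//; first exact: ltW.
    by rewrite -lee_fin -DG; exact: mean_oscillation.
rewrite ge0_integralZl_EFin//; last 2 first.
- by move=> y _; rewrite lee_fin powR_ge0.
- exact: powR_ge0.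
by rewrite EFinM lee_wpmul2l// lee_fin powR_ge0.
Qed.

End one_step.

(** * Distances to a law and functions of a path *)

Section distance_to_law.
Context {R : realType} {Z : completeMetricType R} {d : measure_display}
  {Omega : measurableType d} {P : probability Omega R}.
Hypothesis sepZ : separable_space Z.
Variables (c : R) (xi : {RV P >-> borel Z}).
Hypothesis c_gt0 : (0 < c)%R.

Let cost_ge0 (z z' : Z) : (0 <= c * mdist z z')%R.
Proof. by rewrite mulr_ge0 ?mdist_ge0// ltW. Qed.

Let measurable_cost (z : Z) :
  measurable_fun [set: borel Z] (fun z' => (c * mdist z (z' : Z))%R).
Proof. by apply: measurable_funM => //; exact: measurable_mdistl. Qed.

Lemma Gdist_ge0 z : 0 <= Gdist c xi z.
Proof. by apply: integral_ge0 => z' _; rewrite lee_fin. Qed.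

Lemma Gdist_triangle z z1 : Gdist c xi z <= (c * mdist z z1)%:E + Gdist c xi z1.
Proof.
rewrite -[X in X + _](integral_cst_probability (distribution P xi)).
rewrite -ge0_integralD//; last 3 first.
- by move=> z' _; rewrite lee_fin.
- by move=> z' _; rewrite lee_fin.
- exact/measurable_EFinP.
apply: ge0_le_integral => //.
- by move=> z' _; rewrite lee_fin.
- exact/measurable_EFinP.
- by apply: emeasurable_funD => //; exact/measurable_EFinP.
- move=> z' _; rewrite -EFinD lee_fin -mulrDr ler_wpM2l ?metric_triangle//.
  exact: ltW.
Qed.

Variables (p A : R).
Hypotheses (p_gt0 : (0 < p)%R)
  (moment : \int[P]_w (Gdist c xi (xi w) `^ p) <= A%:E).

(** G is finite at one point, otherwise its moment would be infinite, and then
    everywhere by the triangle inequality. *)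
Lemma Gdist_fin_num z : Gdist c xi z \is a fin_num.
Proof.
have [[z1 Gz1]|] := pselect (exists z1, Gdist c xi z1 \is a fin_num).
  rewrite ge0_fin_numE ?Gdist_ge0//; apply: (le_lt_trans (Gdist_triangle z z1)).
  by rewrite lte_add_pinfty ?ltry// -ge0_fin_numE// Gdist_ge0.
move=> /forallNP Goo; exfalso.
have GE z1 : Gdist c xi z1 = +oo.
  by apply/eqP; rewrite -leye_eq leNgt; apply/negP => h; apply: (Goo z1);
    rewrite ge0_fin_numE ?Gdist_ge0.
move: moment; rewrite (eq_integral (cst +oo)) => [|w _]; last first.
  by rewrite GE poweRyr// gt_eqF.
by rewrite integral_cst_probability.
Qed.

Lemma measurable_Gdist :
  measurable_fun [set: borel Z] (fun z => fine (Gdist c xi (z : Z))).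
Proof.
apply: (@measurable_lipschitz1 _ _ _ _ sepZ c (fun z => fine (Gdist c xi z)) id) => //.
  exact: ltW.
have half z z' : (fine (Gdist c xi z) - fine (Gdist c xi z') <= c * mdist z z')%R.
  rewrite lerBlDr -lee_fin EFinD !fineK ?Gdist_fin_num//.
  exact: Gdist_triangle.
move=> z z'; rewrite ler_norml half andbT.
by have := half z' z; rewrite (metric_sym z'); lra.
Qed.

Lemma Gdist_moment :
  \int[distribution P xi]_z (fine (Gdist c xi (z : Z)) `^ p)%:E <= A%:E.
Proof.
rewrite ge0_integral_distribution//; last 2 first.
- apply/measurable_EFinP; apply: (measurableT_comp (measurable_powR p)).
  exact: measurable_Gdist.
- by move=> z; rewrite lee_fin powR_ge0.
apply: le_trans moment; rewrite le_eqVlt; apply/orP; left; apply/eqP.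
apply: eq_integral => w _ /=.
by rewrite -poweR_EFin fineK// Gdist_fin_num.
Qed.

Lemma law_first_moment z : \int[distribution P xi]_z' (mdist z (z' : Z))%:E < +oo.
Proof.
have := Gdist_fin_num z; rewrite ge0_fin_numE ?Gdist_ge0// /Gdist.
under eq_integral do rewrite EFinM.
rewrite ge0_integralZl_EFin//; last 3 first.
- by move=> z' _; rewrite lee_fin mdist_ge0.
- by apply/measurable_EFinP; exact: measurable_mdistl.
- exact: ltW.
move=> h; rewrite ltey; apply/eqP => E; move: h.
by rewrite E gt0_muley ?lte_fin.
Qed.

End distance_to_law.

Section path_functions.
Context {R : realType} {X : completeMetricType R}.

(** Dependence on x_1, ..., x_(k+1) only, with constant a for the first k of
    these coordinates and constant B for the last one. *)
Definition path_lipschitz (k : nat) (a B : R) (g : (nat -> X) -> R) : Prop :=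
  forall x x' : nat -> X, (`|g x - g x'| <=
    a * \sum_(i < k) mdist (x i.+1) (x' i.+1) + B * mdist (x k.+1) (x' k.+1))%R.

Lemma path_lipschitz_eq k a B g x x' : path_lipschitz k a B g ->
  (forall i, (i <= k)%N -> x i.+1 = x' i.+1) -> g x = g x'.
Proof.
move=> gL xx'; apply/eqP; rewrite -subr_eq0 -normr_le0.
apply: (le_trans (gL x x')).
rewrite xx'// mdistxx mulr0 addr0 big1 ?mulr0// => i _.
by rewrite xx' ?mdistxx// ltnW.
Qed.

Lemma measurable_path_lipschitz d (S : measurableType d) (sepX : separable_space X)
    k a B g (Z : nat -> S -> borel X) : (0 <= a)%R -> (0 <= B)%R ->
  path_lipschitz k a B g ->
  (forall i, (i <= k)%N -> measurable_fun setT (Z i.+1)) ->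
  measurable_fun setT (fun s => g (fun i => Z i s : X)).
Proof.
move=> a0 B0 gL mZ.
have e s : g (fun i => Z i s : X) = g (fun i => Z i.-1.+1 s : X).
  exact: path_lipschitz_eq gL _.
rewrite (funext e).
apply: (@measurable_lipschitz _ _ _ _ sepX k.+1 (a + B) (fun x => g (fun i => x i.-1)) (fun i => Z i.+1)) => //.
- exact: addr_ge0.
- move=> x x'; apply: (le_trans (gL _ _)) => /=.
  rewrite big_ord_recr/= mulrDl !mulrDr.
  have s0 : (0 <= \sum_(i < k) mdist (x i) (x' i))%R.
    by apply: sumr_ge0 => i _; exact: mdist_ge0.
  have := mulr_ge0 a0 (mdist_ge0 (x k) (x' k)).
  by have := mulr_ge0 B0 s0; lra.
Qed.

End path_functions.

(** * Moment bound along the chain *)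

Section chain_concentration.
Context {R : realType} {X Y : completeMetricType R} {d : measure_display}
  {Omega : measurableType d} {P : probability Omega R}.
Hypotheses (sepX : separable_space X) (sepY : separable_space Y).
Variables (eps : nat -> {RV P >-> borel Y}) (X_ : nat -> {RV P >-> borel X}).
Hypothesis eps_indep : mutually_independent P [set i | (1 <= i)%N] eps.
Hypothesis eps_id : identically_distributed [set i | (1 <= i)%N] eps.
Hypothesis X1_indep : independent_of_family P (X_ 1%N) [set i | (2 <= i)%N] eps.
Variable F : borel X * borel Y -> borel X.
Hypothesis mF : measurable_fun [set: (borel X * borel Y)%type] F.
Variables (rho C : R).
Hypotheses (rho_lt1 : (rho < 1)%R) (C_gt0 : (0 < C)%R).
Hypothesis contract : forall x x' : X,
  \int[distribution P (eps 1%N)]_y (mdist (F (x, y) : X) (F (x', y) : X))%:E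
    <= (rho * mdist x x')%:E.
Hypothesis F_lip : forall (x : X) (y y' : Y),
  (mdist (F (x, y) : X) (F (x, y') : X) <= C * mdist y y')%R.
Hypothesis X_rec : forall n w, (2 <= n)%N -> X_ n w = F (X_ n.-1 w, eps n w).
Variables (p A1 A2 : R).
Hypotheses (p_ge1 : (1 <= p)%R)
  (hA1 : \int[P]_w (Gdist 1%R (X_ 1%N) (X_ 1%N w) `^ p) <= A1%:E)
  (hA2 : \int[P]_w (Gdist C (eps 1%N) (eps 1%N w) `^ p) <= A2%:E).
Variables (kap L : R).
Hypotheses (kap_ge0 : (0 <= kap)%R) (L_ge0 : (0 <= L)%R).
Hypothesis smooth : forall a b : R, (`|a + b| `^ p <=
  (1 + kap) * `|a| `^ p + powR_slope p a * b + L * `|b| `^ p)%R.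
Variables (a B : R).
Hypotheses (a_ge0 : (0 <= a)%R) (BE : (a + B * rho = B)%R).

Let Q := distribution P (eps 1%N).

Let p_gt0 : (0 < p)%R. Proof. exact: lt_le_trans p_ge1. Qed.

Let B_ge0 : (0 <= B)%R.
Proof.
have h : (B * (1 - rho) = a)%R by rewrite mulrBr mulr1 -{1}BE addrK.
by rewrite -(pmulr_lge0 (x := 1 - rho)) ?subr_gt0// h.
Qed.

Let path w : nat -> X := fun i => X_ i w.

(** The chain starts at time 1, so that the coordinate appended to
    x_1, ..., x_(k+1) has index k+2. *)
Definition extend (k : nat) (x : nat -> X) (z : X) : nat -> X :=
  fun i => if i == k.+2 then z else x i.

(** Conditional expectation of g(X_1, ..., X_(k+2)) given
    (X_1, ..., X_(k+1)) = x. *)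
Definition next_mean (k : nat) (g : (nat -> X) -> R) (x : nat -> X) : R :=
  fine (\int[Q]_y (g (extend k x (F (x k.+1, y))))%:E).

Let path_extend k w : path w = extend k (path w) (F (path w k.+1, eps k.+2 w)).
Proof.
by apply/funext => i; rewrite /extend; case: eqP => [->|//]; rewrite /path X_rec.
Qed.

Let extend_lipschitz k g x x' z z' : path_lipschitz k.+1 a B g ->
  (`|g (extend k x z) - g (extend k x' z')| <=
    a * \sum_(i < k.+1) mdist (x i.+1) (x' i.+1) + B * mdist z z')%R.
Proof.
move=> gL; apply: (le_trans (gL _ _)); apply: lerD.
  rewrite ler_wpM2l//; apply: ler_sum => i _.
  by rewrite /extend eqSS ltn_eqF.
by rewrite /extend eqxx.
Qed.

Let measurable_next k g x : path_lipschitz k.+1 a B g ->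
  measurable_fun [set: borel Y] (fun y => g (extend k x (F (x k.+1, y)))).
Proof.
move=> gL.
apply: (@measurable_path_lipschitz _ _ _ _ sepX _ _ _ _
  (fun i y => if i == k.+2 then F (x k.+1, y) else x i)) gL _ => // i _.
by case: (i.+1 == k.+2) => //; exact: measurable_section.
Qed.

Let osc (y y' : borel Y) : R := (B * (C * mdist (y : Y) (y' : Y)))%R.

Let measurable_osc y : measurable_fun [set: borel Y] (osc y).
Proof. by do 2 apply: measurable_funM => //; exact: measurable_mdistl. Qed.

Let next_osc k g x y y' : path_lipschitz k.+1 a B g ->
  (`|g (extend k x (F (x k.+1, y))) - g (extend k x (F (x k.+1, y')))|
     <= osc y y')%R.
Proof.
move=> gL; apply: (le_trans (extend_lipschitz _ _ _ _ gL)).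
rewrite big1 ?mulr0 ?add0r => [|i _]; last exact: mdistxx.
by rewrite ler_wpM2l.
Qed.

Let Gy (y : borel Y) : R := fine (Gdist C (eps 1%N) (y : Y)).

Let osc_mean y : \int[Q]_y' (osc y y')%:E = (B * Gy y)%:E.
Proof.
rewrite /osc; under eq_integral do rewrite EFinM.
rewrite ge0_integralZl_EFin//; last 2 first.
- by move=> y' _; rewrite lee_fin mulr_ge0 ?mdist_ge0// ltW.
- by apply/measurable_EFinP; apply: measurable_funM => //; exact: measurable_mdistl.
rewrite EFinM /Gy fineK//.
exact: (Gdist_fin_num C_gt0 p_gt0 hA2).
Qed.

Let integrable_next k g x : path_lipschitz k.+1 a B g ->
  Q.-integrable setT (fun y => (g (extend k x (F (x k.+1, y))))%:E).
Proof.
move=> gL; apply: (@integrable_oscillation _ _ _ _ _ osc point).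
- exact: measurable_next.
- exact: measurable_osc.
- by move=> y y'; exact: next_osc.
- by rewrite osc_mean ltry.
Qed.

Let next_meanE k g x : path_lipschitz k.+1 a B g ->
  (next_mean k g x)%:E = \int[Q]_y (g (extend k x (F (x k.+1, y))))%:E.
Proof.
by move=> gL; rewrite /next_mean fineK//; apply: integrable_fin_num => //;
  exact: integrable_next.
Qed.

(** Moving the coordinate k+1 acts on g directly, at cost a, and through the
    next position, at cost B rho by the contraction; a + B rho = B makes the
    class stable. *)
Lemma next_mean_lipschitz k g : path_lipschitz k.+1 a B g ->
  path_lipschitz k a B (next_mean k g).
Proof.
move=> gL x x'; rewrite -lee_fin -abse_EFin EFinB !next_meanE//.
rewrite -integralB//; [|exact: integrable_next..].
apply: le_trans (le_abse_integral _ _ _) _ => //.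
  by apply: emeasurable_funB; apply/measurable_EFinP; exact: measurable_next.
pose c := (a * \sum_(i < k.+1) mdist (x i.+1) (x' i.+1))%R.
have c0 : (0 <= c)%R by rewrite mulr_ge0// sumr_ge0// => i _; exact: mdist_ge0.
have mFF : measurable_fun [set: borel Y]
    (fun y => (mdist (F (x k.+1, y) : X) (F (x' k.+1, y) : X))%:E).
  by apply/measurable_EFinP; apply: measurable_mdist => //; exact: measurable_section.
apply: (@le_trans _ _ (\int[Q]_y (cst c%:E y +
    B%:E * (mdist (F (x k.+1, y) : X) (F (x' k.+1, y) : X))%:E))).
  apply: ge0_le_integral => //.
  - apply: measurableT_comp => //.
    by apply: emeasurable_funB; apply/measurable_EFinP; exact: measurable_next.
  - by apply: emeasurable_funD => //; exact: measurable_funeM.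
  - move=> y _; rewrite -EFinB abse_EFin -EFinM -EFinD lee_fin.
    exact: extend_lipschitz.
rewrite ge0_integralD//; last 2 first.
- by move=> y _; rewrite mule_ge0// lee_fin ?mdist_ge0.
- exact: measurable_funeM.
rewrite integral_cst_probability ge0_integralZl_EFin//; last first.
  by move=> y _; rewrite lee_fin mdist_ge0.
apply: (@le_trans _ _ (c%:E + B%:E * (rho * mdist (x k.+1) (x' k.+1))%:E)).
  by rewrite leeD2l// lee_wpmul2l ?lee_fin// contract.
rewrite -EFinM -EFinD lee_fin /c big_ord_recr/= -[in leRHS]BE; lra.
Qed.

Lemma measurable_path k g : path_lipschitz k a B g ->
  measurable_fun setT (fun w => g (path w)).
Proof.
move=> gL.
exact: (@measurable_path_lipschitz _ _ _ _ sepX _ _ _ _ (fun i w => X_ i w)) gL _.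
Qed.

Let joint k g (z : past eps X_ k.+1 * borel Y) : R :=
  g (extend k (path z.1) (F (path z.1 k.+1, z.2))).

Let measurable_joint k g : path_lipschitz k.+1 a B g ->
  measurable_fun setT (@joint k g).
Proof.
move=> gL.
have mX i : (i < k.+1)%N ->
    measurable_fun setT (fun z : past eps X_ k.+1 * borel Y => X_ i.+1 z.1).
  move=> ik; apply: (measurableT_comp _ measurable_fst).
  exact: (past_measurable_X mF X_rec ik).
pose Z i (z : past eps X_ k.+1 * borel Y) : borel X :=
  if i == k.+2 then F (X_ k.+1 z.1, z.2) else X_ i z.1.
apply: (@measurable_path_lipschitz _ _ _ _ sepX _ _ _ _ Z a_ge0 B_ge0 gL) => i ik.
rewrite /Z; case: (eqVneq i.+1 k.+2) => [_|ik2].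
  by apply: (measurableT_comp mF); apply: measurable_fun_pair => //; exact: mX.
by apply: mX; rewrite ltn_neqAle ik andbT -(eqSS i).
Qed.

Let past_eps_indep k (E : set (past eps X_ k.+1)) (A : set (borel Y)) :
  measurable E -> measurable A ->
  P (id @^-1` E `&` eps k.+2 @^-1` A) = P (id @^-1` E) * Q A.
Proof.
move=> mE mA; rewrite (past_indep eps_indep X1_indep _ mE mA)//.
by congr (_ * _); exact: (eps_id (i := k.+2) (j := 1%N)).
Qed.

(** Induction on the length of the chain.  Given the past up to time k+1, the
    last position is a function of the independent noise eps_(k+2), and
    g oscillates by at most B C delta(y, y') when the noise moves from y to y'.
    So moment_step, applied to the noise with the past held fixed, compares the
    moment for g with that for its conditional mean, and each step adds
    at most L B^p A2.  For the chain of length one, the increment is governed by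
    the moment of G_{X_1} instead.  Integrability comes together with
    the moment bound, and it is what identifies the two means by Fubini. *)
Lemma chain_moment k g : path_lipschitz k a B g ->
  P.-integrable setT (fun w => (g (path w))%:E) /\
  \int[P]_w (`|g (path w) - fine (\int[P]_w' (g (path w'))%:E)| `^ p)%:E <=
    ((1 + kap) ^+ k * (1 + k%:R * L) * (B `^ p * Num.max A1 A2))%:E.
Proof.
elim: k g => [|k IH] g gL.
  pose g1 (z : borel X) : R := g (fun=> z : X).
  have gE w : g (path w) = g1 (X_ 1%N w).
    by apply: path_lipschitz_eq gL _ => i; rewrite leqn0 => /eqP ->.
  have mg1 : measurable_fun setT g1.
    exact: (@measurable_path_lipschitz _ _ _ _ sepX _ _ _ _ (fun i z => z)) gL _.
  pose osc1 (z z' : borel X) : R := (B * (1 * mdist (z : X) (z' : X)))%R.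
  have mosc1 z : measurable_fun setT (osc1 z).
    by do 2 apply: measurable_funM => //; exact: measurable_mdistl.
  have g1osc z z' : (`|g1 z - g1 z'| <= osc1 z z')%R.
    by apply: (le_trans (gL _ _)); rewrite big_ord0 mulr0 add0r /osc1 mul1r.
  pose G1 (z : borel X) : R := fine (Gdist 1%R (X_ 1%N) (z : X)).
  have osc1_mean z : \int[distribution P (X_ 1%N)]_z' (osc1 z z')%:E = (B * G1 z)%:E.
    rewrite /osc1; under eq_integral do rewrite EFinM.
    rewrite ge0_integralZl_EFin//; last 2 first.
    - by move=> z' _; rewrite lee_fin mulr_ge0 ?mdist_ge0.
    - by apply/measurable_EFinP; apply: measurable_funM => //; exact: measurable_mdistl.
    rewrite EFinM /G1 fineK//.
    exact: (Gdist_fin_num ltr01 p_gt0 hA1).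
  have ig1 : (distribution P (X_ 1%N)).-integrable setT (fun z => (g1 z)%:E).
    apply: (@integrable_oscillation _ _ _ _ _ osc1 point) => //.
    by rewrite osc1_mean ltry.
  have ig : P.-integrable setT (fun w => (g (path w))%:E).
    apply: (eq_integrable measurableT _ _ _ (integrable_distribution ig1)) => // w _.
    by rewrite /= gE.
  split => //; rewrite expr0 mul1r mul0r addr0 mul1r.
  have mE : \int[P]_w (g (path w))%:E = \int[distribution P (X_ 1%N)]_z (g1 z)%:E.
    rewrite integral_distribution//; last exact: integrable_distribution.
      by apply: eq_integral => w _; rewrite gE.
    exact/measurable_EFinP.
  rewrite mE; set m := fine _.
  have mpow : measurable_fun setT (fun z => (`|g1 z - m| `^ p)%:E).
    apply/measurable_EFinP; apply: (measurableT_comp (measurable_powR p)).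
    by apply: measurableT_comp => //; exact: measurable_funB.
  under eq_integral do rewrite gE.
  rewrite -(ge0_integral_distribution (X_ 1%N) mpow); last first.
    by move=> z; rewrite lee_fin powR_ge0.
  apply: (oscillation_moment p_gt0 mg1 mosc1 g1osc ig1 _ _ B_ge0 osc1_mean).
  - exact: (measurable_Gdist sepX ltr01 p_gt0 hA1).
  - by move=> z; rewrite fine_ge0// Gdist_ge0.
  - apply: le_trans (Gdist_moment sepX ltr01 p_gt0 hA1) _.
    by rewrite lee_fin le_max lexx.
have gL' := next_mean_lipschitz gL.
have [ig' IHm] := IH _ gL'.
set m := fine _ in IHm.
set M := Num.max A1 A2.
set K := (_ * _)%R in IHm.
have A2_ge0 : (0 <= A2)%R.
  rewrite -lee_fin; apply: le_trans hA2; apply: integral_ge0 => w _.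
  exact: poweR_ge0.
have M_ge0 : (0 <= M)%R by rewrite le_max A2_ge0 orbT.
have BM_ge0 : (0 <= B `^ p * M)%R by rewrite mulr_ge0 ?powR_ge0.
have inner w : \int[Q]_y (`|joint g (w : past eps X_ k.+1, y) - m| `^ p)%:E <=
    ((1 + kap) * `|next_mean k g (path w) - m| `^ p + L * (B `^ p * M))%:E.
  apply: moment_step => //.
  - exact: (measurable_next (path w) gL).
  - exact: (integrable_next (path w) gL).
  apply: (oscillation_moment p_gt0 (measurable_next (path w) gL) measurable_osc
    _ (integrable_next (path w) gL) _ _ B_ge0 osc_mean).
  - by move=> y y'; exact: next_osc.
  - exact: (measurable_Gdist sepY C_gt0 p_gt0 hA2).
  - by move=> y; rewrite fine_ge0// Gdist_ge0.
  - apply: le_trans (Gdist_moment sepY C_gt0 p_gt0 hA2) _.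
    by rewrite lee_fin le_max lexx orbT.
have gE w : g (path w) = joint g (w : past eps X_ k.+1, eps k.+2 w).
  by rewrite {1}(path_extend k w).
have mpow c : measurable_fun setT (fun z => (`|@joint k g z - c| `^ p)%:E).
  apply/measurable_EFinP; apply: (measurableT_comp (measurable_powR p)).
  apply: measurableT_comp => //; apply: measurable_funB => //.
  exact: measurable_joint.
have mV : measurable_fun setT (eps k.+2) by [].
have hi := @past_eps_indep k.
have mid := @measurable_to_past _ _ _ _ _ P eps X_ k.+1.
have mgp : measurable_fun setT (fun w => g (path w)) by exact: measurable_path gL.
have mgp' : measurable_fun setT (fun w => next_mean k g (path w)).
  exact: measurable_path gL'.
have mSp : measurable_fun setT (fun w => (`|next_mean k g (path w) - m| `^ p)%:E).
  apply/measurable_EFinP; apply: (measurableT_comp (measurable_powR p)).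
  by apply: measurableT_comp => //; exact: measurable_funB.
have bound : \int[P]_w (`|g (path w) - m| `^ p)%:E <=
    ((1 + kap) * K + L * (B `^ p * M))%:E.
  under eq_integral do rewrite gE.
  have pow0 z : 0 <= (`|@joint k g z - m| `^ p)%:E by rewrite lee_fin powR_ge0.
  rewrite (ge0_integral_indep mid mV hi (mpow m) pow0).
  apply: (@le_trans _ _ (\int[P]_w ((1 + kap)%:E *
      (`|next_mean k g (path w) - m| `^ p)%:E + cst (L * (B `^ p * M))%:E w))).
    apply: ge0_le_integral => //.
    - by move=> w _; apply: integral_ge0 => y _; rewrite lee_fin powR_ge0.
    - exact: (measurableT_comp (measurable_fun_fubini_tonelli_F _ (mpow m) pow0) mid).
    - by apply: emeasurable_funD => //; exact: measurable_funeM.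
  rewrite ge0_integralD//; last 3 first.
  - by move=> w _; rewrite mule_ge0// lee_fin ?powR_ge0// addr_ge0.
  - exact: measurable_funeM.
  - by move=> w _; rewrite lee_fin mulr_ge0.
  rewrite integral_cst_probability ge0_integralZl_EFin//; last first.
    by rewrite addr_ge0.
  rewrite [leRHS]EFinD; apply: leeD2r; rewrite [leRHS]EFinM; apply: lee_wpmul2l => //.
  by rewrite lee_fin addr_ge0.
have ig : P.-integrable setT (fun w => (g (path w))%:E).
  apply: (@le_integrable _ _ _ _ _ measurableT _
    (fun w => (`|m| + 1)%:E + (`|g (path w) - m| `^ p)%:E)).
  - exact/measurable_EFinP.
  - move=> w _; rewrite -EFinD !abse_EFin lee_fin [leRHS]ger0_norm; last first.
      by rewrite !addr_ge0// powR_ge0.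
    have := ler_normD m (g (path w) - m)%R; rewrite addrC subrK.
    have := powR_ge0 `|g (path w) - m|%R p.
    have [u1|u1] := lerP `|g (path w) - m|%R 1%R; first lra.
    by have := le1r_powR (ltW u1) p_ge1; lra.
  - apply: integrableD => //; first exact: finite_measure_integrable_cst.
    apply/integrableP; split.
      apply/measurable_EFinP; apply: (measurableT_comp (measurable_powR p)).
      by apply: measurableT_comp => //; exact: measurable_funB.
    under eq_integral do rewrite abse_EFin ger0_norm ?powR_ge0//.
    by apply: (le_lt_trans bound); rewrite ltry.
have mE : fine (\int[P]_w (g (path w))%:E) = m.
  under eq_integral do rewrite gE.
  rewrite (integral_indep mid mV hi (h := fun z => (joint g z)%:E)).
  - by congr fine; apply: eq_integral => w _; rewrite next_meanE.
  - by apply/measurable_EFinP; exact: measurable_joint.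
  - by apply: (eq_integrable measurableT _ _ _ ig) => w _; rewrite gE.
split => //; rewrite mE; apply: (le_trans bound); rewrite lee_fin.
have c1 : (1 <= (1 + kap) ^+ k.+1)%R by rewrite exprn_ege1// lerDl.
have LM0 : (0 <= L * (B `^ p * M))%R by exact: mulr_ge0.
have := ler_peMl LM0 c1; rewrite /K exprS -[k.+1]addn1 natrD -/M.
move: ((1 + kap) ^+ k)%R (B `^ p)%R => e b; lra.
Qed.

End chain_concentration.

(** * Rates and conclusion *)

Section rates.
Local Open Scope ring_scope.
Context {R : realType}.
Implicit Types (p c D : R) (k : nat).

Lemma rate_le2 p c D k : 0 <= c -> 0 <= D ->
  (1 + 0) ^+ k * (1 + k%:R * c) * (D / k.+1%:R `^ p)
    <= (1 + c) * D / k.+1%:R `^ (p - 1).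
Proof.
move=> c0 D0; rewrite addr0 expr1n mul1r; set N : R := k.+1%:R.
have N0 : 0 < N by rewrite ltr0n.
have -> : (1 + c) * D / N `^ (p - 1) = N * (1 + c) * (D / N `^ p).
  rewrite powRB; last by apply/implyP => _; rewrite gt_eqF.
  rewrite powRr1 ?(ltW N0)//; field.
  by rewrite !gt_eqF// powR_gt0.
rewrite ler_wpM2r ?divr_ge0 ?powR_ge0//.
have NE : N = k%:R + 1 by rewrite /N -addn1 natrD.
have k0 : 0 <= k%:R :> R by rewrite ler0n.
by rewrite NE; nra.
Qed.

(** (1 + q / N)^k <= exp q for k <= N. *)
Lemma rate_ge2 p c D k : 2 <= p -> 0 <= c -> 0 <= D ->
  (1 + 2 * p ^+ 2 / k.+1%:R) ^+ k * (1 + k%:R * (c * k.+1%:R `^ (p / 2 - 1))) *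
    (D / k.+1%:R `^ p)
    <= expR (2 * p ^+ 2) * ((1 + c) * D) / k.+1%:R `^ (p / 2).
Proof.
move=> p2 c0 D0; set N : R := k.+1%:R.
have N0 : 0 < N by rewrite ltr0n.
have N1 : 1 <= N by rewrite ler1n.
have kN : k%:R <= N by rewrite ler_nat.
have q0 : 0 <= 2 * p ^+ 2 by rewrite mulr_ge0// sqr_ge0.
have h1 : (1 + 2 * p ^+ 2 / N) ^+ k <= expR (2 * p ^+ 2).
  apply: (@le_trans _ _ (expR (2 * p ^+ 2 / N) ^+ k)).
    apply: lerXn2r; rewrite ?nnegrE ?expR_ge0//; last exact: expR_ge1Dx.
    by rewrite addr_ge0// divr_ge0// ltW.
  rewrite -expRM_natr ler_expR -mulrA ler_piMr//.
  by rewrite ler_pdivrMl// mulr1.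
have h2 : 1 + k%:R * (c * N `^ (p / 2 - 1)) <= (1 + c) * N `^ (p / 2).
  rewrite mulrDl mul1r; apply: lerD.
    by rewrite -[leLHS](powRr0 N) ler_powR//; lra.
  rewrite mulrCA ler_wpM2l//.
  apply: (@le_trans _ _ (N * N `^ (p / 2 - 1))).
    by rewrite ler_wpM2r// powR_ge0.
  by rewrite mulr_powRB1 ?(ltW N0)//; lra.
have NE : N `^ p = N `^ (p / 2) * N `^ (p / 2).
  by rewrite -powRD -?splitr//; apply/implyP => _; rewrite gt_eqF.
have -> : expR (2 * p ^+ 2) * ((1 + c) * D) / N `^ (p / 2) =
    expR (2 * p ^+ 2) * ((1 + c) * N `^ (p / 2)) * (D / N `^ p).
  by rewrite NE; field; rewrite gt_eqF// powR_gt0.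
rewrite ler_wpM2r ?divr_ge0 ?powR_ge0//.
apply: ler_pM => //; first by rewrite exprn_ge0// addr_ge0// divr_ge0// ltW.
by rewrite addr_ge0// !mulr_ge0// ?powR_ge0.
Qed.

End rates.

Theorem mainTheorem20 (R : realType)
  (X Y : completeMetricType R) (sepX : separable_space X) (sepY : separable_space Y)
  (d : measure_display) (Omega : measurableType d) (P : probability Omega R)
  (eps : nat -> {RV P >-> borel Y}) (X_ : nat -> {RV P >-> borel X})
  (eps_indep : mutually_independent P [set i | (1 <= i)%N] eps)
  (eps_id : identically_distributed [set i | (1 <= i)%N] eps)
  (X1_indep : independent_of_family P (X_ 1%N) [set i | (2 <= i)%N] eps)
  (F : borel X * borel Y -> borel X) (mF : measurable_fun [set: (borel X * borel Y)%type] F)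
  (rho C : R) (rho_ge0 : (0 <= rho)%R) (rho_lt1 : (rho < 1)%R)
  (C_gt0 : (0 < C)%R)
  (F_contract : forall x x' : X,
    \int[P]_w (mdist (F (x, eps 1%N w) : X) (F (x', eps 1%N w) : X))%:E
      <= (rho * mdist x x')%R%:E)
  (F_lip : forall (x : X) (y y' : Y),
    (mdist (F (x, y) : X) (F (x, y') : X) <= C * mdist y y')%R)
  (X_rec : forall (n : nat) (w : Omega), (2 <= n)%N ->
    X_ n w = F (X_ n.-1 w, eps n w))
  (mu : probability (borel X) R) (mu_inv : invariant_distribution F (eps 1%N) mu)
  (p A1 A2 : R) (p_ge1 : (1 <= p)%R)
  (hA1 : \int[P]_w (Gdist 1%R (X_ 1%N) (X_ 1%N w) `^ p) <= A1%:E)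
  (hA2 : \int[P]_w (Gdist C (eps 1%N) (eps 1%N w) `^ p) <= A2%:E) :
  exists C0 : R, forall n : nat, (1 <= n)%N ->
    let W := fun w => W1 (empirical (fun k => X_ k w) n) mu in
    ((p <= 2)%R ->
      'N[P]_p%:E[(fun w => W w - \int[P]_w' W w')] `^ p
        <= (C0 / n%:R `^ (p - 1))%R%:E) /\
    ((2 <= p)%R ->
      'N[P]_p%:E[(fun w => W w - \int[P]_w' W w')] `^ p
        <= (C0 / n%:R `^ (p / 2))%R%:E).
Proof.
have p_gt0 : (0 < p)%R by exact: lt_le_trans p_ge1.
have contract x x' : \int[distribution P (eps 1%N)]_y
    (mdist (F (x, y) : X) (F (x', y) : X))%:E <= (rho * mdist x x')%:E.
  rewrite ge0_integral_distribution//; last by move=> y; rewrite lee_fin mdist_ge0.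
    exact: F_contract.
  by apply/measurable_EFinP; apply: measurable_mdist => //; exact: measurable_section.
have noise_moment := law_first_moment C_gt0 p_gt0 hA2 point.
have mu_moment : exists x0 : X, \int[mu]_z (mdist x0 (z : X))%:E < +oo.
  exists point.
  exact: (invariant_moment sepX mF rho_ge0 rho_lt1 C_gt0 contract F_lip mu_inv noise_moment).
set M := Num.max A1 A2.
have M_ge0 : (0 <= M)%R.
  rewrite le_max -(lee_fin 0 A2); apply/orP; right; apply: le_trans hA2.
  by apply: integral_ge0 => w _; exact: poweR_ge0.
set c := smooth_const p; have c_ge0 : (0 <= c)%R by exact: smooth_const_ge0.
pose D := ((1 - rho)^-1 `^ p * M)%R.
have D_ge0 : (0 <= D)%R by rewrite mulr_ge0 ?powR_ge0.
have CD_ge0 : (0 <= (1 + c) * D)%R by rewrite mulr_ge0// addr_ge0.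
(* One constant serves both ranges of p: the factor exp (2 p^2), which comes
   from the range p >= 2, is at least 1. *)
exists (expR (2 * p ^+ 2) * ((1 + c) * D))%R => -[//|k] _ W.
pose N : R := k.+1%:R.
have N_gt0 : (0 < N)%R by rewrite ltr0n.
pose f (x : nat -> X) : R := fine (W1 (empirical x k.+1) mu).
have WE w : W w = (f (fun i => X_ i w))%:E.
  by rewrite /f fineK//; exact: W1_fin_num.
pose a : R := (N^-1)%R; pose B : R := (a / (1 - rho))%R.
have a_ge0 : (0 <= a)%R by rewrite invr_ge0 ltW.
have rho1 : (0 < 1 - rho)%R by rewrite subr_gt0.
have BE : (a + B * rho = B)%R by rewrite /B; field; rewrite gt_eqF.
have aB : (a <= B)%R by rewrite /B ler_peMr// invf_ge1// gerBl.
have f_half x x' : (f x' - f x <= a * \sum_(i < k) mdist (x i.+1) (x' i.+1)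
    + B * mdist (x k.+1) (x' k.+1))%R.
  apply: (@le_trans _ _ (a * \sum_(i < k.+1) mdist (x i.+1) (x' i.+1))%R).
    rewrite lerBlDl -lee_fin EFinD /f !fineK; last 2 first.
    - exact: W1_fin_num.
    - exact: W1_fin_num.
    exact: W1_lipschitz.
  by rewrite big_ord_recr/= mulrDr lerD2l ler_wpM2r ?mdist_ge0.
have fL : path_lipschitz k a B f.
  move=> x x'; rewrite ler_norml; apply/andP; split.
    by rewrite lerNl opprB; exact: f_half.
  have := f_half x' x; under eq_bigr do rewrite metric_sym.
  by rewrite metric_sym.
have NormE : 'N[P]_p%:E[(fun w => W w - \int[P]_w' W w')] `^ p =
    \int[P]_w (`|W w - \int[P]_w' W w'| `^ p).
  by rewrite poweR_Lnorm// gt_eqF.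
have moment (kap L : R) : (0 <= kap)%R -> (0 <= L)%R ->
    (forall u v : R, (`|u + v| `^ p <=
      (1 + kap) * `|u| `^ p + powR_slope p u * v + L * `|v| `^ p)%R) ->
    'N[P]_p%:E[(fun w => W w - \int[P]_w' W w')] `^ p <=
      ((1 + kap) ^+ k * (1 + k%:R * L) * (D / N `^ p))%:E.
  move=> kap0 L0 smooth.
  have [fi fm] := chain_moment sepX sepY eps_indep eps_id X1_indep mF rho_lt1
    C_gt0 contract F_lip X_rec p_ge1 hA1 hA2 kap0 L0 smooth a_ge0 BE fL.
  rewrite NormE.
  have -> : \int[P]_w' W w' = (fine (\int[P]_w (f (fun i => X_ i w))%:E))%:E.
    rewrite fineK; first by apply: eq_integral => w _; exact: WE.
    exact: integrable_fin_num.
  under eq_integral do rewrite WE -EFinB abse_EFin poweR_EFin.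
  apply: (le_trans fm); rewrite lee_fin.
  rewrite /B /a powRM ?invr_ge0 ?(ltW N_gt0) ?(ltW rho1)//.
  have -> : (N^-1 `^ p = (N `^ p)^-1)%R by rewrite -powR_inv1 ?(ltW N_gt0)// -powRrM mulN1r powRN.
  by rewrite -[X in (_ * X <= _)%R]mulrA [X in (_ * X <= _)%R]mulrC.
split=> hp.
  apply: (le_trans (moment 0%R c (lexx _) c_ge0 _)).
    by move=> u v; rewrite addr0 mul1r; exact: powR_smooth_le2.
  rewrite lee_fin; apply: (le_trans (rate_le2 p k c_ge0 D_ge0)).
  rewrite ler_wpM2r ?invr_ge0 ?powR_ge0// ler_peMl//.
  by rewrite -expR0 ler_expR mulr_ge0// sqr_ge0.
apply: (le_trans (moment (2 * p ^+ 2 / N)%R (c * N `^ (p / 2 - 1))%R _ _ _)).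
- by rewrite divr_ge0 ?(ltW N_gt0)// mulr_ge0// sqr_ge0.
- by rewrite mulr_ge0// powR_ge0.
- by move=> u v; apply: powR_smooth_ge2 => //; rewrite ler1n.
by rewrite lee_fin; exact: rate_ge2.
Qed.
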